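(* Let $K$ be the Kronecker quiver (two vertices $1,2$ and two arrows $1\to2$), let $\mathbf x=\{x_1,x_2\}$, $\mathbf y=\{y_1,y_2\}$, $\mathbf y^\delta=y_1y_2$, and $$u(\mathbf y)=\frac{x_1^2+y_1y_2x_2^2+y_2}{x_1x_2}.$$ Then the set $$\mathcal B^{\mathbf y}(K)=\{\text{cluster monomials}\}\sqcup\{F_n^{\mathbf y^\delta}(u(\mathbf y))\mid n\ge1\}$$ is a canonically positive $\mathbb Z\hat{\mathbb P}$-basis of $\hat{\mathcal A}(K,\mathbf x,\mathbf y)$.
   Context: Cluster algebra: $\mathcal A(K,\mathbf x,\mathbf y)$ is the cluster algebra with principal coefficients at the initial seed $(K,\mathbf x,\mathbf y)$. Concretely, $\mathbb P=\mathrm{Trop}(\mathbf y)$ is the free abelian multiplicative group on $y_1,y_2$, so $\mathbb Z\mathbb P=\mathbb Z[y_1^{\pm1},y_2^{\pm1}]$, and $\mathcal A(K,\mathbf x,\mathbf y)$ is the $\mathbb Z\mathbb P$-subalgebra of $\mathbb Q(y_1,y_2,x_1,x_2)$ generated by all cluster variables obtained by iterated seed mutation at the mutable vertices $1,2$ from the ice quiver with mutable vertices $1,2$ (variables $x_1,x_2$), frozen vertices $1',2'$ (variables $y_1,y_2$), two arrows $1\to2$ and arrows $1\to1'$, $2\to2'$. (The first exchange relations are $x_1x_1'=y_1x_2^2+1$ and $x_2x_2'=x_1^2+y_2$.) Clusters are the pairs of cluster variables occurring in a seed; cluster monomials are monomials in the cluster variables of a single cluster. Completion: $\hat{\mathbb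 P}=\mathbb Q\otimes_{\mathbb Z}\mathbb P$ (written multiplicatively) is obtained from $\mathbb P$ by adjoining roots of all degrees of all elements of $\mathbb P$; $\hat{\mathcal A}(K,\mathbf x,\mathbf y)$ is the $\mathbb Z\hat{\mathbb P}$-algebra obtained from $\mathcal A(K,\mathbf x,\mathbf y)$ by extension of scalars from $\mathbb Z\mathbb P$ to $\mathbb Z\hat{\mathbb P}$. An element of $\hat{\mathcal A}(K,\mathbf x,\mathbf y)$ is positive if in every cluster it can be written as a Laurent polynomial with coefficients in $\mathbb Z_{\ge0}\hat{\mathbb P}$ (the nonnegative integral combinations of elements of $\hat{\mathbb P}$). A $\mathbb Z\hat{\mathbb P}$-basis $\mathcal B$ is canonically positive if the positive elements are exactly the $\mathbb Z_{\ge0}\hat{\mathbb P}$-linear combinations of elements of $\mathcal B$. Quantized Chebyshev polynomials of the first kind: $F_0^q(x)=1$, $F_1^q(x)=x$, $F_2^q(x)=x^2-2q$, $F_{n+1}^q(x)=xF_n^q(x)-qF_{n-1}^q(x)$ for $n\ge2$; $F_n^{\mathbf y^\delta}$ is the specialization $q=\mathbf y^\delta=y_1y_2$. *)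

(* Defs.v *)
From HB Require Import structures.
From mathcomp Require Import all_boot all_order all_algebra.
From mathcomp Require Import finmap.
From mathcomp Require Import boolp classical_sets.
From mathcomp.multinomials Require Import monalg.
From mathcomp.multinomials Require Import mpoly.

Set Implicit Arguments.
Unset Strict Implicit.
Unset Printing Implicit Defensive.

Import Order.TTheory GRing.Theory Num.Theory.
Local Open Scope classical_set_scope.
Local Open Scope ring_scope.

(* The integral group ring Z[G] of an abelian group G. The group is written
   additively, so the product of the basis elements at g and h is the basis
   element at g + h. (The product of monalg.v does not apply: its monoids have
   no unit but 1.) *)
Section GroupRing.
Variable G : zmodType.

Definition group_ring : Type := malg G int.

HB.instance Definition _ := GRing.Zmodule.on group_ring.

Implicit Types (r s t : group_ring) (g h : G).

Definition gr_exp g : group_ring := mkmalgU g 1.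

Definition gr_mul r s : group_ring :=
  \sum_(g <- monalg.msupp r) \sum_(h <- monalg.msupp s)
    mkmalgU (g + h) (monalg.mcoeff g r * monalg.mcoeff h s).

Let gr_mulw (d1 d2 : {fset G}) r s :
  (monalg.msupp r `<=` d1)%fset -> (monalg.msupp s `<=` d2)%fset ->
  gr_mul r s = \sum_(g <- d1) \sum_(h <- d2)
    mkmalgU (g + h) (monalg.mcoeff g r * monalg.mcoeff h s).
Proof.
move=> le1 le2; rewrite /gr_mul (big_fset_incl _ le1) /=.
  apply: eq_bigr => g _; apply: big_fset_incl => // h _ /monalg.mcoeff_outdom ->.
  by rewrite mulr0 monalgU0.
move=> g _ /monalg.mcoeff_outdom rg.
by rewrite big1 // => h _; rewrite rg mul0r monalgU0.
Qed.

Let gr_mulUU (a b : int) g h :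
  gr_mul (mkmalgU g a) (mkmalgU h b) = mkmalgU (g + h) (a * b).
Proof. by rewrite (gr_mulw monalg.msuppU_le monalg.msuppU_le) !big_seq_fset1 !monalg.mcoeffUU. Qed.

Let gr_mulC : commutative gr_mul.
Proof.
move=> r s; rewrite /gr_mul exchange_big; apply: eq_bigr => h _.
by apply: eq_bigr => g _; rewrite addrC mulrC.
Qed.

Let gr_mulDl : left_distributive gr_mul +%R.
Proof.
move=> r s t.
rewrite (gr_mulw (monalg.msuppD_le r s) (fsubset_refl _)).
rewrite (gr_mulw (fsubsetUl _ (monalg.msupp s)) (fsubset_refl (monalg.msupp t))).
rewrite (gr_mulw (fsubsetUr (monalg.msupp r) _) (fsubset_refl (monalg.msupp t))).
rewrite -big_split /=; apply: eq_bigr => g _.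
rewrite -big_split /=; apply: eq_bigr => h _.
by rewrite monalg.mcoeffD mulrDl monalgUD.
Qed.

Let gr_mulDr : right_distributive gr_mul +%R.
Proof. by move=> r s t; rewrite gr_mulC gr_mulDl !(gr_mulC _ r). Qed.

Let gr_mul0 : left_zero 0 gr_mul.
Proof. by move=> r; rewrite /gr_mul monalg.msupp0 big_seq_fset0. Qed.

Let gr_mul1 : left_id (gr_exp 0) gr_mul.
Proof.
move=> r; rewrite (gr_mulw monalg.msuppU_le (fsubset_refl _)) big_seq_fset1.
rewrite [RHS]monalgE; apply: eq_bigr => h _.
by rewrite add0r monalg.mcoeffUU mul1r.
Qed.

Let gr_mul_sumr (I : Type) (c : seq I) r (F : I -> group_ring) :
  gr_mul r (\sum_(i <- c) F i) = \sum_(i <- c) gr_mul r (F i).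
Proof.
apply: (big_morph (gr_mul r)) => [s t|]; first exact: gr_mulDr.
by rewrite gr_mulC gr_mul0.
Qed.

Let gr_mul_suml (I : Type) (c : seq I) r (F : I -> group_ring) :
  gr_mul (\sum_(i <- c) F i) r = \sum_(i <- c) gr_mul (F i) r.
Proof. by rewrite gr_mulC gr_mul_sumr; apply: eq_bigr => i _; exact: gr_mulC. Qed.

Let gr_mulA : associative gr_mul.
Proof.
move: gr_mulUU gr_mul_sumr gr_mul_suml; generalize gr_mul.
move=> mul mulUU mulr mull r s t; rewrite (monalgE r) (monalgE s) (monalgE t).
rewrite !mull; apply: eq_bigr => g _.
rewrite [LHS]mulr [mul (mkmalgU _ _) (\sum_(h <- monalg.msupp s) _)]mulr.
rewrite [RHS]mull; apply: eq_bigr => h _.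
rewrite [mul (mkmalgU h _) _]mulr [LHS]mulr [RHS]mulr; apply: eq_bigr => k _.
by rewrite !mulUU addrA mulrA.
Qed.

Let gr_one_neq0 : gr_exp 0 != 0.
Proof. by rewrite monalgU_eq0. Qed.

HB.instance Definition _ := GRing.Zmodule_isComNzRing.Build group_ring
  gr_mulA gr_mulC gr_mul1 gr_mulDl gr_one_neq0.

Lemma gr_expD g h : gr_exp (g + h) = gr_exp g * gr_exp h.
Proof. by rewrite [RHS]gr_mulUU mul1r. Qed.

Lemma gr_exp0 : gr_exp 0 = 1.
Proof. by []. Qed.

Definition gr_nonneg : set group_ring :=
  [set r | forall g, 0 <= monalg.mcoeff g r].

Definition gr_lift (S : nzRingType) (f : G -> S) : group_ring -> S :=
  monalg.mmap intr f.

Lemma gr_lift_is_additive (S : nzRingType) (f : G -> S) :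
  zmod_morphism (gr_lift f).
Proof. by move=> r s; exact: monalg.mmapB. Qed.

Lemma gr_lift_is_monoid_morphism (S : comNzRingType) (f : G -> S) :
  f 0 = 1 -> {morph f : g h / g + h >-> g * h} -> monoid_morphism (gr_lift f).
Proof.
move=> f0 fD; have liftU g a : gr_lift f (mkmalgU g a) = a%:~R * f g.
  exact: monalg.mmapU.
have lift_sum (I : Type) (c : seq I) (F : I -> group_ring) :
    gr_lift f (\sum_(i <- c) F i) = \sum_(i <- c) gr_lift f (F i).
  exact: (raddf_sum (monalg.mmap intr f)).
split=> [|r s]; first by rewrite liftU f0 mulr1.
rewrite [r * s]/(gr_mul r s) /gr_mul lift_sum [gr_lift f r]/gr_lift.
rewrite monalg.mmapE mulr_suml; apply: eq_bigr => g _.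
rewrite lift_sum [gr_lift f s]/gr_lift monalg.mmapE mulr_sumr.
by apply: eq_bigr => h _; rewrite liftU fD intrM mulrACA.
Qed.

End GroupRing.

Section ExtensionOfScalars.
Variables (R S : comNzRingType) (phi : {rmorphism R -> S}).
Variables (A : comAlgType R) (Ahat : comAlgType S).
Variable j : {lrmorphism A -> Ahat | phi \; *:%R}.

(* (Ahat, j) is the S-algebra S (x)_R A: the universal property of extension of
   scalars of commutative algebras along phi. *)
Definition is_scalar_extension : Prop :=
  forall (C : comAlgType S) (f : {lrmorphism A -> C | phi \; *:%R}),
    exists2 h : {lrmorphism Ahat -> C}, h \o j =1 f &
      forall h' : {lrmorphism Ahat -> C}, h' \o j =1 f -> h' =1 h.

End ExtensionOfScalars.

Section Bases.
Variables (R : nzRingType) (V : lmodType R).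

Definition lincombs (N : set R) (B : set V) : set V :=
  [set v | exists (s : seq V) (c : V -> R),
    [/\ forall b, b \in s -> B b, forall b, b \in s -> N (c b)
      & v = \sum_(b <- s) c b *: b]].

Definition lin_independent (B : set V) : Prop :=
  forall (s : seq V) (c : V -> R), uniq s -> (forall b, b \in s -> B b) ->
    \sum_(b <- s) c b *: b = 0 -> forall b, b \in s -> c b = 0.

Definition is_basis (B : set V) : Prop :=
  lin_independent B /\ lincombs setT B = setT.

End Bases.

(* Ice quivers without loops and 2-cycles on n mutable vertices (lshift m i) and
   m frozen ones (rshift n i), encoded by the skew-symmetric matrix Q with
   Q i j = #(arrows i -> j) - #(arrows j -> i). Arrows between frozen vertices
   may be created by mutation, but do not affect any exchange relation. *)
Section Seeds.
Variables n m : nat.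

Definition ice_quiver := 'M[int]_(n + m).

Implicit Types (Q : ice_quiver) (i j k : 'I_(n + m)).

Definition arrows Q i j : nat := if 0 <= Q i j then `|Q i j|%N else 0%N.

Definition mutate_quiver k Q : ice_quiver :=
  \matrix_(i, j) if (i == k) || (j == k) then - Q i j
    else Q i j + (arrows Q i k * arrows Q k j)%:Z
               - (arrows Q j k * arrows Q k i)%:Z.

Definition ambient_field := {fraction mpoly (n + m) rat}.

Record seed := Seed {
  seed_var : 'I_(n + m) -> ambient_field;
  seed_quiver : ice_quiver }.

Definition mutate k (s : seed) : seed :=
  let x := seed_var s in let Q := seed_quiver s in
  {| seed_var := fun i =>
       if i == k then (\prod_j x j ^+ arrows Q k j +
                       \prod_j x j ^+ arrows Q j k) / x k
       else x i;
     seed_quiver := mutate_quiver k Q |}.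

Definition initial_var i : ambient_field := @tofrac (mpoly (n + m) rat) 'X_i.

Definition initial_seed Q : seed :=
  {| seed_var := initial_var; seed_quiver := Q |}.

(* The seed reached by mutating successively at the mutable vertices in w. *)
Definition seed_at Q (w : seq 'I_n) : seed :=
  foldl (fun (s : seed) (i : 'I_n) => mutate (lshift m i) s) (initial_seed Q) w.

Definition cluster_var Q (w : seq 'I_n) (i : 'I_n) : ambient_field :=
  seed_var (seed_at Q w) (lshift m i).

Definition cluster_monomials Q : set ambient_field :=
  [set z | exists (w : seq 'I_n) (a : 'I_n -> nat),
    z = \prod_(i < n) cluster_var Q w i ^+ a i].

End Seeds.

(* ZP and its completion: P = Z^m is the free abelian group on the frozen
   variables, and its completion is Q (x)_Z P = Q^m. *)
Definition ZP (m : nat) := group_ring 'rV[int]_m.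
Definition ZPhat (m : nat) := group_ring 'rV[rat]_m.
HB.instance Definition _ m := GRing.ComNzRing.on (ZP m).
HB.instance Definition _ m := GRing.ComNzRing.on (ZPhat m).

Section Coefficients.
Variables n m : nat.

Definition completion : ZP m -> ZPhat m :=
  gr_lift (fun v : 'rV[int]_m => gr_exp (map_mx intr v : 'rV[rat]_m)).

Definition frozen_monomial (v : 'rV[int]_m) : ambient_field n m :=
  \prod_(i < m) initial_var (rshift n i) ^ v 0 i.

Definition coef_embedding : ZP m -> ambient_field n m := gr_lift frozen_monomial.

Lemma initial_var_neq0 (i : 'I_(n + m)) : initial_var i != 0.
Proof.
rewrite tofrac_eq0; apply/eqP => /(congr1 (mcoeff U_(i)%MM)).
by rewrite mcoeffX eqxx mcoeff0 => /eqP; rewrite oner_eq0.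
Qed.

Fact completion_is_additive : zmod_morphism completion.
Proof. exact: gr_lift_is_additive. Qed.

Fact completion_is_monoid_morphism : monoid_morphism completion.
Proof.
apply: gr_lift_is_monoid_morphism => [|v w]; first by rewrite map_mx0.
by rewrite map_mxD gr_expD.
Qed.

HB.instance Definition _ := GRing.isZmodMorphism.Build _ _ completion
  completion_is_additive.
HB.instance Definition _ := GRing.isMonoidMorphism.Build _ _ completion
  completion_is_monoid_morphism.

Fact coef_embedding_is_additive : zmod_morphism coef_embedding.
Proof. exact: gr_lift_is_additive. Qed.

Fact coef_embedding_is_monoid_morphism : monoid_morphism coef_embedding.
Proof.
apply: gr_lift_is_monoid_morphism => [|v w].
  by apply: big1 => i _; rewrite mxE expr0z.
rewrite -big_split; apply: eq_bigr => i _.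
by rewrite mxE expfzDr // initial_var_neq0.
Qed.

HB.instance Definition _ := GRing.isZmodMorphism.Build _ _ coef_embedding
  coef_embedding_is_additive.
HB.instance Definition _ := GRing.isMonoidMorphism.Build _ _ coef_embedding
  coef_embedding_is_monoid_morphism.

End Coefficients.

Section ClusterAlgebra.
Variables (n m : nat) (Q : ice_quiver n m).

Inductive in_cluster_algebra : ambient_field n m -> Prop :=
| InCoef r : in_cluster_algebra (coef_embedding n r)
| InVar w i : in_cluster_algebra (cluster_var Q w i)
| InAdd x y : in_cluster_algebra x -> in_cluster_algebra y ->
    in_cluster_algebra (x + y)
| InMul x y : in_cluster_algebra x -> in_cluster_algebra y ->
    in_cluster_algebra (x * y).

Definition cluster_pred : {pred ambient_field n m} :=
  fun x => `[< in_cluster_algebra x >].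

Fact cluster_pred_subring : subring_closed cluster_pred.
Proof.
have N1 : in_cluster_algebra (-1) by rewrite -(rmorphN1 (@coef_embedding n m));
  exact: InCoef.
split=> [|x y /asboolP Ax /asboolP Ay|x y /asboolP Ax /asboolP Ay]; apply/asboolP.
- by rewrite -(rmorph1 (@coef_embedding n m)); exact: InCoef.
- by apply: InAdd => //; rewrite -mulN1r; exact: InMul.
- exact: InMul.
Qed.

HB.instance Definition _ := GRing.isSubringClosed.Build _ cluster_pred
  cluster_pred_subring.

Record cluster_algebra := ClusterAlgebra {
  ca_val : ambient_field n m;
  ca_valP : ca_val \in cluster_pred }.

HB.instance Definition _ := [isSub for ca_val].
HB.instance Definition _ := [Choice of cluster_algebra by <:].
HB.instance Definition _ := [SubChoice_isSubComNzRing of cluster_algebra by <:].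

Fact coef_in_cluster_algebra (r : ZP m) : coef_embedding n r \in cluster_pred.
Proof. by apply/asboolP; exact: InCoef. Qed.

Definition ca_coef (r : ZP m) : cluster_algebra :=
  ClusterAlgebra (coef_in_cluster_algebra r).

Definition ca_scale (r : ZP m) (x : cluster_algebra) : cluster_algebra :=
  ca_coef r * x.

Fact ca_scaleA r s x : ca_scale r (ca_scale s x) = ca_scale (r * s) x.
Proof. by apply: val_inj; rewrite /= rmorphM mulrA. Qed.

Fact ca_scale1 : left_id 1 ca_scale.
Proof. by move=> x; apply: val_inj; rewrite /= rmorph1 mul1r. Qed.

Fact ca_scaleDr : right_distributive ca_scale +%R.
Proof. by move=> r x y; exact: mulrDr. Qed.

Fact ca_scaleDl x : {morph ca_scale^~ x : r s / r + s}.
Proof. by move=> r s; apply: val_inj; rewrite /= rmorphD mulrDl. Qed.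

HB.instance Definition _ := GRing.Zmodule_isLmodule.Build (ZP m) cluster_algebra
  ca_scaleA ca_scale1 ca_scaleDr ca_scaleDl.

Fact ca_scaleAl r (x y : cluster_algebra) : r *: (x * y) = (r *: x) * y.
Proof. exact: mulrA. Qed.

HB.instance Definition _ := GRing.Lmodule_isLalgebra.Build (ZP m) cluster_algebra
  ca_scaleAl.
HB.instance Definition _ := GRing.Lalgebra_isComAlgebra.Build (ZP m) cluster_algebra.

Fact cluster_var_in_cluster_algebra w i : cluster_var Q w i \in cluster_pred.
Proof. by apply/asboolP; exact: InVar. Qed.

Definition ca_var (w : seq 'I_n) (i : 'I_n) : cluster_algebra :=
  ClusterAlgebra (cluster_var_in_cluster_algebra w i).

End ClusterAlgebra.

Section CanonicallyPositive.
Variables (n m : nat) (Q : ice_quiver n m).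
Variables (Ahat : comAlgType (ZPhat m)).
Variable j : cluster_algebra Q -> Ahat.

(* "e is a Laurent polynomial in z_1, .., z_n with nonnegative coefficients" is
   stated with the denominator z^a cleared. *)
Definition positive_element : set Ahat :=
  [set e | forall w : seq 'I_n,
    let z := fun i => j (ca_var Q w i) in
    exists (a : 'I_n -> nat) (p : mpoly n (ZPhat m)),
      (forall u, gr_nonneg p@_u) /\
      (\prod_(i < n) z i ^+ a i) * e = mmap (in_alg Ahat) z p].

Definition canonically_positive_basis (B : set Ahat) : Prop :=
  is_basis B /\ positive_element = lincombs (gr_nonneg (G := _)) B.

End CanonicallyPositive.

Fixpoint chebyshev (R : nzRingType) (q x : R) (k : nat) : R :=
  match k with
  | 0 => 1
  | 1 => x
  | 2 => x ^+ 2 - 2 * q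
  | (k2.+1 as k1).+1 => x * chebyshev q x k1 - q * chebyshev q x k2
  end.

Definition kronecker_arrows (i j : nat) : nat :=
  match i, j with
  | 0, 1 => 2
  | 0, 2 => 1
  | 1, 3 => 1
  | _, _ => 0
  end.

(* Vertices 1, 2, 1', 2' are numbered 0, 1, 2, 3. *)
Definition kronecker : ice_quiver 2 2 :=
  \matrix_(i, j) ((kronecker_arrows i j)%:Z - (kronecker_arrows j i)%:Z).

Definition kronecker_x1 : ambient_field 2 2 := initial_var (lshift 2 0).
Definition kronecker_x2 : ambient_field 2 2 := initial_var (lshift 2 1).
Definition kronecker_y1 : ambient_field 2 2 := initial_var (rshift 2 0).
Definition kronecker_y2 : ambient_field 2 2 := initial_var (rshift 2 1).

Definition kronecker_u : ambient_field 2 2 :=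
  (kronecker_x1 ^+ 2 + kronecker_y1 * kronecker_y2 * kronecker_x2 ^+ 2
   + kronecker_y2) / (kronecker_x1 * kronecker_x2).

Definition kronecker_F : set (ambient_field 2 2) :=
  [set chebyshev (kronecker_y1 * kronecker_y2) kronecker_u k
    | k in [set k | (1 <= k)%N]].

Definition kronecker_basis : set (ambient_field 2 2) :=
  cluster_monomials kronecker `|` kronecker_F.

(* Main.v *)
From HB Require Import structures.
From mathcomp Require Import all_boot all_order all_algebra.
From mathcomp Require Import polyXY.
From mathcomp Require Import finmap.
From mathcomp Require Import boolp classical_sets.
From mathcomp Require Import zify ring.
From mathcomp.multinomials Require monalg.
From mathcomp.multinomials Require Import mpoly.
Require Import Defs.

Set Implicit Arguments.
Unset Strict Implicit.
Unset Printing Implicit Defensive.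

Import Order.TTheory GRing.Theory Num.Theory.
Local Open Scope classical_set_scope.
Local Open Scope ring_scope.

(** Rescaling the cluster variables by square roots of monomials in y_1, y_2
    removes all coefficients.  Let x_k (k in Z) be the cluster variables, the
    clusters being the pairs {x_k, x_(k+1)}, with x_0, x_1 the initial ones.
    For suitable integer vectors g_k (g_exponent) the elements
    z_k = y^(g_k / 2) x_k satisfy z_(k-1) z_(k+1) = z_k^2 + 1 and the linear
    recurrence z_(k+1) + z_(k-1) = z z_k with z = y^(- delta / 2) u.  Moreover
    F_n^q(u) = y^(n delta / 2) F_n^1(z) for q = y^delta.  So, up to invertible
    scalars with nonnegative inverses, the basis consists of the monomials
    z_m^a z_(m+1)^b and of the F_n(z) with q = 1, and all clusters look alike.

    Spanning.  By these relations the span is stable under multiplication by z.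
    Multiplying z_m^a z_(m+1)^b by z_m or z_(m+1) gives such a monomial again,
    and the recurrence then reaches every z_k; so the span is a subalgebra
    (span_mul).  It contains the image of the cluster algebra, which generates
    the extension of scalars (scalar_extension_generated).

    Reading off coefficients.  z_p and z_(p+1) are algebraically independent
    over the scalars: for the initial cluster this is seen in a Laurent ring, to
    which the Laurent phenomenon and the universal property give a map
    (kronecker_laurent_model), and exchange relations preserve independence
    (alg_indep2_exchange).  So an element has at most one Laurent expansion in
    each cluster.  Newton polygons (cluster_slice, chebyshev_slice) show that
    among all basis elements only z_p^a z_(p+1)^b itself has this monomial in
    its expansion at the cluster p, and that z_p^n z_(p+1)^(-n) occurs in F_n(z),
    with coefficient 1, but in no other F_k(z) and in no monomial from the
    cluster p or a cluster to the right of it.  Hence each coefficient of a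
    linear combination of basis elements is, up to an invertible monomial, a
    coefficient of its Laurent expansion in some cluster
    (kronecker_coefficient).  This gives linear independence, and it shows that
    positive elements have nonnegative coefficients.

    Positivity.  The sequences z_k and D_k = z_0 z_(k+1) - z_1 z_k (rec_cross)
    satisfy a system of recurrences without subtraction, so all z_k are positive
    in the cluster {z_0, z_1}, and by symmetry in every cluster.  Then F_n(z) is
    positive because z_p F_n(z) = z_(p+n) + z_(p-n). *)

(** * Sequences with a linear recurrence and Chebyshev polynomials *)

(** Two consecutive terms determine a solution of a second-order recurrence in
    both directions, so statements about all its terms are proved this way. *)
Lemma int_ind2 (P : int -> Prop) (k0 : int) :
  P k0 -> P (k0 + 1) ->
  (forall k, P (k - 1) -> P k -> P (k + 1)) ->
  (forall k, P (k + 1) -> P k -> P (k - 1)) -> forall k, P k.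
Proof.
move=> P0 P1 up dn.
have upn (n : nat) : P (k0 + n%:Z) /\ P (k0 + n%:Z + 1).
  elim: n => [|n [IH1 IH2]]; first by rewrite addr0.
  have -> : k0 + n.+1%:Z = k0 + n%:Z + 1 by lia.
  by split=> //; apply: up => //; rewrite addrK.
have dnn (n : nat) : P (k0 - n%:Z) /\ P (k0 - n%:Z + 1).
  elim: n => [|n [IH1 IH2]]; first by rewrite subr0.
  have -> : k0 - n.+1%:Z = k0 - n%:Z - 1 by lia.
  by split; [exact: dn | rewrite subrK].
move=> k; case: (leP k0 k) => [lek|/ltW lek].
  have -> : k = k0 + `|k - k0|%N%:Z by lia.
  by case: (upn `|k - k0|%N).
have -> : k = k0 - `|k - k0|%N%:Z by lia.
by case: (dnn `|k - k0|%N).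
Qed.

Section Recurrence.
Variables (R : comNzRingType) (q u : R).

Definition linear_rec (z : int -> R) : Prop :=
  forall k, z (k + 1) + q * z (k - 1) = u * z k.

Section Identities.
Variable z : int -> R.
Hypothesis zP : linear_rec z.

Lemma linear_rec_next k : z (k + 1) = u * z k - q * z (k - 1).
Proof. by rewrite -zP addrK. Qed.

(** The polynomial q X^2 - u z_k X + z_k^2 + rec_defect k vanishes at z_(k-1); its
    other root is z_(k+1) / q. *)
Definition rec_defect k := u * z (k - 1) * z k - q * z (k - 1) ^+ 2 - z k ^+ 2.

(** Linear recurrences thus produce exchange relations: a single value of the
    defect determines all of them, by rec_defectS. *)
Lemma rec_exchange k : z (k - 1) * z (k + 1) = z k ^+ 2 + rec_defect k.
Proof. by rewrite linear_rec_next /rec_defect; ring. Qed.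

Lemma rec_defectS k : rec_defect (k + 1) = q * rec_defect k.
Proof. by rewrite /rec_defect addrK linear_rec_next; ring. Qed.

(** Recovers u from four consecutive terms; this is why u belongs to the cluster
    algebra. *)
Lemma rec_distance3 k :
  z (k - 1) * z (k + 2) = z k * z (k + 1) + u * rec_defect k.
Proof.
have -> : k + 2 = k + 1 + 1 by lia.
rewrite linear_rec_next addrK mulrBr [z (k - 1) * (u * _)]mulrCA rec_exchange.
by rewrite linear_rec_next; ring.
Qed.

Lemma chebyshevSS n :
  chebyshev q u n.+3 = u * chebyshev q u n.+2 - q * chebyshev q u n.+1.
Proof. by []. Qed.

(** On a solution l^k of the recurrence, where u = l + q / l, the polynomial F_n
    takes the value l^n + (q / l)^n, which shifts the index by n in both
    directions. *)
Lemma chebyshev_shift n k :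
  chebyshev q u n.+1 * z k = z (k + n.+1%:Z) + q ^+ n.+1 * z (k - n.+1%:Z).
Proof.
suff [] : chebyshev q u n.+1 * z k
      = z (k + n.+1%:Z) + q ^+ n.+1 * z (k - n.+1%:Z)
    /\ chebyshev q u n.+2 * z k
      = z (k + n.+2%:Z) + q ^+ n.+2 * z (k - n.+2%:Z) by [].
elim: n => [|n [IH1 IH2]].
  split; first by rewrite /= expr1 -zP.
  have up := zP (k + 1); have dn := zP (k - 1).
  rewrite addrK subrK in up dn.
  have -> : k + 2%:Z = k + 1 + 1 by lia.
  have -> : k - 2%:Z = k - 1 - 1 by lia.
  rewrite [chebyshev _ _ _]/= mulrBl !expr2 -(mulrA u) -zP mulrDr.
  by rewrite [u * (q * _)]mulrCA -up -dn; ring.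
split=> //; rewrite chebyshevSS mulrBl -(mulrA u) -(mulrA q) IH1 IH2.
have up := zP (k + n.+2%:Z); have dn := zP (k - n.+2%:Z).
have e1 : k + n.+3%:Z = k + n.+2%:Z + 1 by lia.
have e2 : k - n.+3%:Z = k - n.+2%:Z - 1 by lia.
have e3 : k + n.+1%:Z = k + n.+2%:Z - 1 by lia.
have e4 : k - n.+1%:Z = k - n.+2%:Z + 1 by lia.
rewrite e1 e2 e3 e4 (exprS q n.+2) (exprS q n.+1).
move: (q ^+ n.+1) => Q.
by rewrite mulrDr [u * (_ * z _)]mulrCA -up -dn; ring.
Qed.

End Identities.

Let run (c d a b : R) (n : nat) : R :=
  (iter n (fun p : R * R => (p.2, c * p.2 - d * p.1)) (a, b)).1.

(** The solution with terms a and b at the indices 0 and 1.  Here q' is the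
    inverse of q, by which the recurrence runs backwards. *)
Definition linear_seq (q' a b : R) (k : int) : R :=
  match k with
  | Posz n => run u q a b n
  (* Negz n is the index - n - 1, which is n + 2 steps to the left of 1. *)
  | Negz n => run (q' * u) q' b a n.+2
  end.

Lemma linear_seqP (q' a b : R) : q' * q = 1 -> linear_rec (linear_seq q' a b).
Proof.
move=> qV.
have runSS c d x y n :
  run c d x y n.+2 = c * run c d x y n.+1 - d * run c d x y n by [].
rewrite /linear_seq => -[[|n]|n].
- rewrite [0 + 1]/= [0 - 1]/= /run /=.
  rewrite mulrBr !mulrA [q * q']mulrC qV !mul1r; ring.
- have -> : n.+1%:Z + 1 = n.+2 by lia.
  have -> : n.+1%:Z - 1 = n by lia.
  by rewrite runSS subrK.
- have -> : Negz n - 1 = Negz n.+1 by lia.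
  rewrite runSS; case: n => [|n].
    have -> : Negz 0 + 1 = 0 by lia.
    rewrite mulrBr !mulrA [q * q']mulrC qV !mul1r /run /=; ring.
  have -> : Negz n.+1 + 1 = Negz n by lia.
  rewrite mulrBr !mulrA [q * q']mulrC qV !mul1r; ring.
Qed.

End Recurrence.

(** The recurrence of the Chebyshev polynomials starts at n = 3: with F_0 = 1,
    the polynomial F_2 = x^2 - 2 q differs from x F_1 - q F_0. *)
Lemma chebyshev_ind (P : nat -> Prop) :
  P 0 -> P 1 -> P 2 -> (forall n, P n.+1 -> P n.+2 -> P n.+3) ->
  forall n, P n.
Proof.
move=> P0 P1 P2 PS n; suff [] : [/\ P n, P n.+1 & P n.+2] by [].
by elim: n => // n [p0 p1 p2]; split=> //; exact: PS.
Qed.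

Lemma rmorph_chebyshev (R R' : comNzRingType) (f : {rmorphism R -> R'}) q u n :
  f (chebyshev q u n) = chebyshev (f q) (f u) n.
Proof.
elim/chebyshev_ind: n => [|||n IH1 IH2]; rewrite ?chebyshevSS //.
- exact: rmorph1.
- by rewrite /= rmorphB rmorphXn rmorphM rmorph_nat.
by rewrite rmorphB !rmorphM IH1 IH2.
Qed.

(** With s^2 = y^delta this removes the coefficient q = y^delta. *)
Lemma chebyshev_scale (R : comNzRingType) (s q u : R) n :
  chebyshev (s ^+ 2 * q) (s * u) n = s ^+ n * chebyshev q u n.
Proof.
elim/chebyshev_ind: n => [|||n IH1 IH2]; rewrite ?chebyshevSS.
- by rewrite expr0 mulr1.
- by rewrite expr1.
- by rewrite /=; ring.
by rewrite IH1 IH2 (exprS s n.+2) (exprS s n.+1); ring.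
Qed.

(** * The recurrence without coefficients and its Newton polygons *)

Section MarkovSequence.
Variables (R : comNzRingType) (u : R) (z : int -> R).
Hypothesis zP : linear_rec 1 u z.
Hypothesis z01 : z 0 ^+ 2 + z 1 ^+ 2 + 1 = u * z 0 * z 1.

(** The recurrence replaces one root of a quadratic equation by the other, so
    the equation passes from one pair of neighbours to the next. *)
Lemma markov_triple k : z k ^+ 2 + z (k + 1) ^+ 2 + 1 = u * z k * z (k + 1).
Proof.
have d1 : rec_defect 1 u z 1 = 1 by rewrite /rec_defect subrr -z01; ring.
have dS (k' : int) : rec_defect 1 u z (k' + 1) = rec_defect 1 u z k'.
  by rewrite (rec_defectS zP) mul1r.
have dk : rec_defect 1 u z (k + 1) = 1.
  move: k; apply: (@int_ind2 _ 0) => [||k _ IH|k _ IH]; rewrite ?add0r //.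
  - by rewrite dS d1.
  - by rewrite dS.
  by rewrite subrK -dS.
by rewrite -[X in _ + X = _]dk /rec_defect addrK; ring.
Qed.

Lemma markov_exchange k : z (k - 1) * z (k + 1) = z k ^+ 2 + 1.
Proof.
rewrite (rec_exchange zP); congr (_ + _).
by have := markov_triple (k - 1); rewrite subrK /rec_defect mul1r => <-; ring.
Qed.

Lemma markov_shift p : linear_rec 1 u (fun k => z (p + k)).
Proof. by move=> k; rewrite /= -zP !addrA. Qed.

Lemma markov_reflect p : linear_rec 1 u (fun k => z (p - k)).
Proof.
move=> k; rewrite mul1r addrC.
by have := zP (p - k); rewrite mul1r => <-; congr (z _ + z _); lia.
Qed.

(** The point of this combination is rec_crossS: together with
    z_0 z_(k+1) = z_1 z_k + rec_cross k it computes z_(k+1) without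
    subtraction. *)
Definition rec_cross k := z 0 * z (k + 1) - z 1 * z k.

Lemma rec_crossS k :
  z 0 * z 1 * rec_cross (k + 1) = z 1 * z k + (z 0 ^+ 2 + 1) * rec_cross k.
Proof.
rewrite /rec_cross (linear_rec_next zP (k + 1)) addrK.
transitivity
  (z 0 * (u * z 0 * z 1 - z 1 ^+ 2) * z (k + 1) - z 0 ^+ 2 * z 1 * z k).
  by ring.
by rewrite -z01; ring.
Qed.

End MarkovSequence.

Section Degree.
Variables (S : comNzRingType) (L : comAlgType S) (mon : int -> int -> L).
Hypotheses (mon0 : mon 0 0 = 1)
  (monD : forall i j k l, mon i j * mon k l = mon (i + k) (j + l)).
Variables (alpha beta : int).
Implicit Types (x y : L) (d : int).

(** The monomial mon i j has weight alpha i + beta j.  The bound asks for an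
    expression by monomials of weight at most d, so that it is inherited by
    sums and products without any look at coefficients. *)
Definition deg_le d x : Prop :=
  exists2 r : seq (S * (int * int)),
    all (fun t => alpha * t.2.1 + beta * t.2.2 <= d) r
    & x = \sum_(t <- r) t.1 *: mon t.2.1 t.2.2.

Lemma deg_le_mon d i j : alpha * i + beta * j <= d -> deg_le d (mon i j).
Proof.
move=> ij; exists [:: (1, (i, j))]; first by rewrite /= ij.
by rewrite big_seq1 scale1r.
Qed.

Lemma deg_leW d d' x : d <= d' -> deg_le d x -> deg_le d' x.
Proof.
move=> dd' [r rd ->]; exists r => //.
by apply: sub_all rd => t /le_trans; apply.
Qed.

Lemma deg_leD d x y : deg_le d x -> deg_le d y -> deg_le d (x + y).
Proof.
move=> [r rd ->] [s sd ->]; exists (r ++ s); first by rewrite all_cat rd.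
by rewrite big_cat.
Qed.

Lemma deg_leZ d s x : deg_le d x -> deg_le d (s *: x).
Proof.
move=> [r rd ->]; exists [seq (s * t.1, t.2) | t <- r].
  by rewrite all_map; apply: sub_all rd.
by rewrite big_map scaler_sumr; apply: eq_bigr => t _; rewrite scalerA.
Qed.

Lemma deg_leB d x y : deg_le d x -> deg_le d y -> deg_le d (x - y).
Proof. by move=> dx dy; rewrite -scaleN1r; apply/deg_leD/deg_leZ. Qed.

Lemma deg_leM d1 d2 x y : deg_le d1 x -> deg_le d2 y -> deg_le (d1 + d2) (x * y).
Proof.
move=> [r rd ->] [s sd ->].
exists [seq (a.1 * b.1, (a.2.1 + b.2.1, a.2.2 + b.2.2)) | a <- r, b <- s].
  apply/allP => t /allpairsP [[a b] [ar bs ->]] /=.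
  by rewrite !mulrDr addrACA lerD // ?(allP rd _ ar) ?(allP sd _ bs).
rewrite big_allpairs_dep /= mulr_suml; apply: eq_bigr => a _.
rewrite mulr_sumr; apply: eq_bigr => b _ /=.
by rewrite -scalerAl -scalerAr scalerA monD.
Qed.

Lemma deg_leXn d x n : deg_le d x -> deg_le (d * n%:Z) (x ^+ n).
Proof.
move=> dx; elim: n => [|n IH].
  by rewrite expr0 -mon0; apply: deg_le_mon; rewrite !mulr0.
by rewrite exprS -add1n PoszD mulrDr mulr1; apply: deg_leM.
Qed.

Lemma deg_le_slice (slice : int -> int -> {scalar L}) d x i j :
    (forall k l, slice i j (mon k l) = ((k, l) == (i, j))%:R) ->
  deg_le d x -> d < alpha * i + beta * j -> slice i j x = 0.
Proof.
move=> slice_mon [r rd ->] dij; rewrite raddf_sum big_seq big1 // =>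
  t /(allP rd) td.
rewrite /= scalarZ slice_mon; case: eqP => [[ti tj]|]; last by rewrite mulr0.
by move: td; rewrite ti tj => /(lt_le_trans dij); rewrite ltxx.
Qed.

End Degree.

Section NewtonPolygon.
Variables (S : comNzRingType) (L : comAlgType S) (mon : int -> int -> L).
Hypotheses (mon0 : mon 0 0 = 1)
  (monD : forall i j k l, mon i j * mon k l = mon (i + k) (j + l)).
Variables (alpha beta : int) (u : L) (z : int -> L) (a b : int) (X' Y' : L).
Hypothesis zP : linear_rec 1 u z.
Hypothesis z01 : z 0 ^+ 2 + z 1 ^+ 2 + 1 = u * z 0 * z 1.
Hypotheses (XV : X' * z 0 = 1) (YV : Y' * z 1 = 1).
Hypotheses (degX : deg_le mon alpha beta a (z 0)) (degX' : deg_le mon alpha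
  beta (- a) X').
Hypotheses (degY : deg_le mon alpha beta b (z 1)) (degY' : deg_le mon alpha
  beta (- b) Y').
Hypotheses (leba : b <= a) (b_ge0 : 0 <= b).

(** For k >= 2 the Newton polygon of z_k is the triangle with vertices (1-k, k),
    (1-k, 2-k) and (k-3, 2-k), and for weights a >= b >= 0 of z_0 and z_1 the
    maximum is attained at the first or the last one; here k = n + 1.  In
    z_(k+1) = u z_k - z_(k-1) the leading terms cancel, so the induction runs
    over the subtraction-free system of z and rec_cross instead. *)
Lemma newton_bound (n : nat) d :
  - n%:Z * a + (n%:Z + 1) * b <= d -> (n%:Z - 2) * a - (n%:Z - 1) * b <= d ->
  deg_le mon alpha beta d (z (n%:Z + 1)).
Proof.
have one_deg : deg_le mon alpha beta 0 (1 : L).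
  by rewrite -mon0; apply: deg_le_mon; rewrite !mulr0.
have zS k : z (k + 1) = X' * (z 1 * z k + rec_cross z k).
  by rewrite /rec_cross [z 1 * z k + _]addrC subrK mulrA XV mul1r.
have crossS k : rec_cross z (k + 1) =
    X' * z k + (z 0 * Y' + X' * Y') * rec_cross z k.
  transitivity (X' * z 0 * (Y' * z 1) * rec_cross z (k + 1)).
    by rewrite XV YV !mul1r.
  transitivity (X' * Y' * (z 0 * z 1 * rec_cross z (k + 1))); first by ring.
  rewrite (rec_crossS zP z01).
  transitivity (X' * (Y' * z 1) * z k +
    ((X' * z 0) * z 0 * Y' + X' * Y') * rec_cross z k); first by ring.
  by rewrite XV YV mul1r mulr1.
suff [zd _] : (forall d, - n%:Z * a + (n%:Z + 1) * b <= d ->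
    (n%:Z - 2) * a - (n%:Z - 1) * b <= d ->
      deg_le mon alpha beta d (z (n%:Z + 1))) /\
    deg_le mon alpha beta (n%:Z * (a - b)) (rec_cross z (n%:Z + 1)) by exact: zd.
elim: n {d} => [|n [IHz IHc]].
  rewrite add0r; split=> [d d1 _|]; first by apply: deg_leW degY; lia.
  rewrite -[X in rec_cross z X]add0r crossS /rec_cross add0r [z 1 * z 0]mulrC
    subrr.
  by rewrite mulr0 addr0 XV; apply: deg_leW one_deg; lia.
have -> : n.+1%:Z = n%:Z + 1 by lia.
have nab : 0 <= n%:Z * (a - b) by apply: mulr_ge0 => //; lia.
split=> [d d1 d2|].
  rewrite zS -[d](addKr a); apply: (deg_leM monD) => //; apply: deg_leD.
    have -> : a + d = b + (a + d - b) by lia.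
    apply: (deg_leM monD) => //.
    by apply: IHz; lia.
  by apply: deg_leW IHc; lia.
rewrite crossS; apply: deg_leD.
  rewrite -[X in deg_le _ _ _ X _](addKr a); apply: (deg_leM monD) => //.
  by apply: IHz; lia.
rewrite mulrDl mul1r addrC; apply: (deg_leM monD) => //; apply: deg_leD.
  exact: (deg_leM monD).
by apply: deg_leW (deg_leM monD degX' degY'); lia.
Qed.

End NewtonPolygon.

Section Slices.
Variables (S : comNzRingType) (L : comAlgType S) (mon : int -> int -> L).
Variable slice : int -> int -> {scalar L}.
Hypotheses (mon0 : mon 0 0 = 1)
  (monD : forall i j k l, mon i j * mon k l = mon (i + k) (j + l))
  (slice_mon : forall i j k l, slice i j (mon k l) = ((k, l) == (i, j))%:R).
Variables (u : L) (z : int -> L).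
Hypotheses (zP : linear_rec 1 u z) (z0 : z 0 = mon 1 0) (z1 : z 1 = mon 0 1).
Hypothesis uE : u = mon 1 (- 1) + mon (- 1) 1 + mon (- 1) (- 1).

Lemma monXn i j n : mon i j ^+ n = mon (i * n%:Z) (j * n%:Z).
Proof.
elim: n => [|n IH]; first by rewrite expr0 !mulr0 mon0.
by rewrite exprS IH monD -add1n PoszD !mulrDr !mulr1.
Qed.

Lemma laurent_z01 : z 0 ^+ 2 + z 1 ^+ 2 + 1 = u * z 0 * z 1.
Proof. by rewrite z0 z1 uE -mulrA monD !mulrDl !monD !monXn -mon0. Qed.

Lemma deg_right (alpha beta : int) (r d : int) :
  1 <= r -> 0 <= beta -> beta <= alpha ->
  (1 - r) * alpha + r * beta <= d -> (r - 3) * alpha - (r - 2) * beta <= d ->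
  deg_le mon alpha beta d (z r).
Proof.
move=> r1 b0 ba d1 d2; have -> : r = `|r - 1|%N%:Z + 1 by lia.
have rn : `|r - 1|%N%:Z = r - 1 by lia.
apply: (@newton_bound _ _ mon mon0 monD alpha beta u z alpha beta
  (mon (- 1) 0) (mon 0 (- 1)) zP laurent_z01) => //; rewrite ?z0 ?z1 ?monD //.
1-4: by apply: deg_le_mon; rewrite ?mulr0 ?addr0 ?add0r ?mulrN ?mulr1.
- by rewrite rn opprB subrK.
- rewrite rn; have -> : r - 1 - 2 = r - 3 by lia.
  by have -> : r - 1 - 1 = r - 2 by lia.
Qed.

(** The reflection k -> 1 - k of the sequence exchanges z_0 and z_1. *)
Lemma deg_left (alpha beta : int) (r d : int) :
  r <= 0 -> 0 <= alpha -> alpha <= beta ->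
  r * beta + (1 - r) * alpha <= d -> (- r - 2) * beta + (r + 1) * alpha <= d ->
  deg_le mon alpha beta d (z r).
Proof.
move=> r1 b0 ba d1 d2.
have -> : z r = (fun k => z (1 - k)) (`|r|%N%:Z + 1) by congr z; lia.
have rn : `|r|%N%:Z = - r by lia.
apply: (@newton_bound _ _ mon mon0 monD alpha beta u _ beta alpha
  (mon 0 (- 1)) (mon (- 1) 0) (markov_reflect zP 1)) => //; rewrite ?subr0 ?subrr.
- by rewrite [X in X + 1]addrC laurent_z01; ring.
1-6: rewrite ?z0 ?z1 ?monD //.
1-4: by apply: deg_le_mon; rewrite ?mulr0 ?addr0 ?add0r ?mulrN ?mulr1.
- by rewrite rn opprK [1 - r]addrC in d1 *.
- rewrite rn; apply: le_trans d2; lia.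
Qed.

(** A cluster monomial that does not lie in the cluster {z_0, z_1} has no terms in
    the first quadrant and, if its cluster is to the right, none at (n, -n) with
    n > 0: some weight is negative on it but nonnegative at these exponents.  The
    condition i = 0 -> j = 0 excludes the exponents of the powers of z_1, which
    lie in two clusters. *)
Lemma cluster_slice r (a b : nat) i j :
    (0 < a)%N -> (i = 0 -> j = 0) ->
    (0 <= i /\ 0 <= j) \/ [/\ 0 <= r, 0 < i & j = - i] ->
  slice i j (z r ^+ a * z (r + 1) ^+ b) =
    ((r == 0) && ((a%:Z, b%:Z) == (i, j)))%:R.
Proof.
move=> a_gt0 ij0 hij.
have vanish alpha beta d d' :
    deg_le mon alpha beta d (z r) -> deg_le mon alpha beta d' (z (r + 1)) ->
    d * a%:Z + d' * b%:Z < alpha * i + beta * j ->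
    slice i j (z r ^+ a * z (r + 1) ^+ b) = 0.
  move=> dr dr1; apply: (deg_le_slice (mon := mon)) => //.
  by apply: (deg_leM monD); apply: deg_leXn.
have [r2|] := leP 2 r.
  rewrite gt_eqF /=; last by lia.
  (* z_r and z_(r+1) both have negative weight when the quotient of the weights
     lies between r / (r - 1) and (r - 1) / (r - 2); this is the mediant. *)
  apply: (vanish (2 * r - 1) (2 * r - 3) (- 1) (- 1)).
  1-2: by apply: deg_right; nia.
  by case: hij => [[]|[]]; nia.
have [r1|r_neq1 r_lt2] := eqVneq r 1.
  subst r => _ /=; case: b vanish => [|b] vanish.
    rewrite expr0 mulr1 z1 monXn slice_mon; case: eqP => // -[]; lia.
  apply: (vanish 1 0 0 (- 1)).
  1-2: by apply: deg_right; lia.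
  by case: hij => [[]|[]]; lia.
have [r0|r_neq0] := eqVneq r 0.
  subst r; rewrite add0r z0 z1 !monXn monD slice_mon /=.
  by rewrite !mul0r !mul1r addr0 add0r.
have {}hij : 0 <= i /\ 0 <= j by case: hij => // -[]; lia.
have [rN1|r_neqN1] := eqVneq r (- 1).
  subst r; rewrite /=; apply: (vanish 0 1 (- 1) 0).
  1-2: by apply: deg_left; lia.
  by case: hij; lia.
rewrite /=; apply: (vanish (- 2 * r - 3) (- 2 * r - 1) (- 1) (- 1)).
1-2: by apply: deg_left; nia.
by case: hij => hi hj; nia.
Qed.

(** With t = z_1 / z_0, the terms of total degree above -1 are those of the
    solution z_0 t^k of the recurrence with t + 1 / t in the place of u. *)
Lemma leading_term k : deg_le mon 1 1 (- 1) (z k - mon (1 - k) k).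
Proof.
pose m k := mon (1 - k) k.
have mS k' : m (k' + 1) + m (k' - 1) = (mon 1 (- 1) + mon (- 1) 1) * m k'.
  rewrite /m mulrDl !monD [RHS]addrC; congr (mon _ _ + mon _ _); lia.
have step k' : (z (k' + 1) - m (k' + 1)) + (z (k' - 1) - m (k' - 1)) =
    (mon 1 (- 1) + mon (- 1) 1 + mon (- 1) (- 1)) * (z k' - m k')
    + mon (- 1) (- 1) * m k'.
  have := zP k'; rewrite mul1r uE => zk.
  transitivity (z (k' + 1) + z (k' - 1) - (m (k' + 1) + m (k' - 1))).
    by ring.
  by rewrite zk mS; ring.
have deg_step k' : deg_le mon 1 1 (- 1) (z k' - m k') -> deg_le mon 1 1 (- 1)
    ((mon 1 (- 1) + mon (- 1) 1 + mon (- 1) (- 1)) * (z k' - m k')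
    + mon (- 1) (- 1) * m k').
  move=> dk; apply: deg_leD; last first.
    by rewrite monD; apply: deg_le_mon; lia.
  rewrite -[X in deg_le _ _ _ X _]add0r; apply: (deg_leM monD) => //.
  by do 2?apply: deg_leD; apply: deg_le_mon.
have deg0 : deg_le mon 1 1 (- 1) 0.
  by rewrite -[0](scale0r (mon (- 1) 0)); apply/deg_leZ/deg_le_mon.
move: k; apply: (@int_ind2 _ 0) => [||k dk1 dk|k dk1 dk].
- by rewrite z0 subr0 subrr.
- by rewrite add0r z1 subrr.
- rewrite -(addrK (z (k - 1) - m (k - 1)) (z _ - _)) step.
  by apply: deg_leB => //; apply: deg_step.
- rewrite -(addKr (z (k + 1) - m (k + 1)) (z _ - _)) step addrC.
  by apply: deg_leB => //; apply: deg_step.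
Qed.

(** F_n(u) is t^n + t^-n, with t = z_1 / z_0, plus terms of total degree at most
    -2, because z_0 F_n(u) = z_n + z_(-n). *)
Lemma chebyshev_slice n i j :
    (0 <= i /\ 0 <= j) \/ (0 < i /\ j = - i) ->
  slice i j (chebyshev 1 u n.+1) = ((n.+1%:Z, - n.+1%:Z) == (i, j))%:R.
Proof.
move=> hij; pose N := n.+1%:Z.
pose R k := z k - mon (1 - k) k.
have F_E : chebyshev 1 u n.+1 =
    mon (- N) N + mon N (- N) + mon (- 1) 0 * (R N + R (- N)).
  have := chebyshev_shift zP n 0; rewrite expr1n mul1r add0r sub0r z0 -/N.
  move=> /(congr1 ( *%R (mon (- 1) 0))).
  rewrite mulrCA monD addr0 addNr mon0 mulr1 => ->; rewrite /R.
  have -> : mon (- N) N = mon (- 1) 0 * mon (1 - N) N.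
    by rewrite monD; congr mon; lia.
  have -> : mon N (- N) = mon (- 1) 0 * mon (1 - - N) (- N).
    by rewrite monD; congr mon; lia.
  by ring.
have deg_rest : deg_le mon 1 1 (- 1 + - 1) (mon (- 1) 0 * (R N + R (- N))).
  apply: (deg_leM monD); first exact: deg_le_mon.
  by apply: deg_leD; apply: leading_term.
rewrite F_E !raddfD /= (deg_le_slice (slice_mon i j) deg_rest); last first.
  by case: hij => [[]|[]]; lia.
rewrite addr0 !slice_mon; case: eqP => [[]|_]; last by rewrite add0r.
by rewrite /N; case: hij => [[]|[]]; lia.
Qed.

End Slices.

(** * Algebraic independence and Laurent expansions *)

Section BivariateEvaluation.
Variables (S : comNzRingType) (E : comAlgType S).
Implicit Types (P : {poly {poly S}}).

Definition eval2 (a b : E) P : E := (map_poly (map_poly (in_alg E)) P).[b, a].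

Lemma eval2_is_zmod_morphism a b : zmod_morphism (eval2 a b).
Proof. by move=> P Q; rewrite /eval2 rmorphB !hornerE. Qed.

Lemma eval2_is_monoid_morphism a b : monoid_morphism (eval2 a b).
Proof.
split=> [|P Q]; first by rewrite /eval2 rmorph1 !hornerE.
by rewrite /eval2 rmorphM /= !hornerM.
Qed.

HB.instance Definition _ a b := GRing.isZmodMorphism.Build _ _ (eval2 a b)
  (eval2_is_zmod_morphism a b).
HB.instance Definition _ a b := GRing.isMonoidMorphism.Build _ _ (eval2 a b)
  (eval2_is_monoid_morphism a b).

Lemma eval2C a b s : eval2 a b s%:P%:P = s%:A.
Proof. by rewrite /eval2 map_polyC hornerC /= map_polyC hornerC. Qed.

Lemma eval2X a b : eval2 a b 'X%:P = a.
Proof. by rewrite /eval2 map_polyC hornerC /= map_polyX hornerX. Qed.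

Lemma eval2Y a b : eval2 a b 'X = b.
Proof. by rewrite /eval2 map_polyX hornerX hornerC. Qed.

Lemma eval2_polyC a b p : eval2 a b p%:P = (map_poly (in_alg E) p).[a].
Proof. by rewrite /eval2 map_polyC hornerC. Qed.

Definition alg_indep2 (a b : E) : Prop := forall P, eval2 a b P = 0 -> P = 0.

Lemma alg_indep2_sym a b : alg_indep2 a b -> alg_indep2 b a.
Proof.
move=> indep P P0; apply: (can_inj swapXYK); rewrite [RHS]raddf0.
by apply: indep; rewrite /eval2 -swapXY_map horner2_swapXY.
Qed.

Lemma eval2_sum a b P :
  eval2 a b P = \sum_(i < size P) eval2 a b (P`_i)%:P * b ^+ i.
Proof.
rewrite -[P in LHS]coefK poly_def rmorph_sum; apply: eq_bigr => i _.
by rewrite -mul_polyC rmorphM rmorphXn /= eval2Y.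
Qed.

(** Since b b' = a^2 + 1, a power of b times P(a, b') is a polynomial in a and b.
    Its coefficients are those of P times powers of the monic, hence regular,
    polynomial X^2 + 1. *)
Lemma alg_indep2_exchange a b b' :
  b * b' = a ^+ 2 + 1 -> alg_indep2 a b -> alg_indep2 a b'.
Proof.
move=> exch indep P P0; pose N := size P.
pose f : {poly S} := 'X ^+ 2 + 1.
have f_reg i : GRing.rreg (f ^+ i).
  by apply/monic_rreg/monic_exp; rewrite /f -[1]/(1%:P) monicXnaddC.
(* Q(a, b) is b^N P(a, b') with b^j b'^j replaced by (a^2 + 1)^j. *)
pose Q := \poly_(i < N.+1) (P`_(N - i) * f ^+ (N - i)).
have Q0 : Q = 0.
  apply: indep; transitivity (b ^+ N * eval2 a b' P); last by rewrite P0 mulr0.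
  rewrite /Q poly_def rmorph_sum (reindex_inj rev_ord_inj) /=.
  rewrite big_ord_recr /= (eval2_sum _ b') mulr_sumr.
  rewrite subSS subnn subn0 nth_default // mul0r scale0r rmorph0 addr0.
  apply: eq_bigr => i _.
  have lei : (i <= N)%N by exact: ltnW.
  rewrite subSS subKn // -mul_polyC polyCM !rmorphM !rmorphXn /= eval2Y.
  rewrite /f rmorphD rmorphXn !rmorph1 rmorphD rmorphXn rmorph1 /= eval2X.
  have -> : b ^+ N = b ^+ (N - i) * b ^+ i by rewrite -exprD subnK.
  by rewrite -exch exprMn !eval2_polyC; ring.
apply/polyP => i; rewrite coef0; case: (ltnP i N) => [ltiN|]; last first.
  by move=> leNi; rewrite nth_default.
have /polyP/(_ (N - i)%N) := Q0; rewrite coef0 coef_poly ltnS leq_subr.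
by rewrite subKn 1?ltnW // -[X in _ = X](mul0r (f ^+ i)) => /f_reg.
Qed.

End BivariateEvaluation.

Section LaurentExpansion.
Variables (S : comNzRingType) (E C : comAlgType S) (P : comNzRingType).
Variables (evE : {rmorphism P -> E}) (evC : {rmorphism P -> C}).
Variables (cst : S -> P) (X Y : P) (x' y' : C).
Hypotheses (evE_cst : forall s, evE (cst s) = s%:A)
  (evC_cst : forall s, evC (cst s) = s%:A).
Hypothesis evE_inj : forall p, evE p = 0 -> p = 0.
Local Notation a := (evE X).
Local Notation b := (evE Y).
Local Notation x := (evC X).
Local Notation y := (evC Y).
Hypotheses (xV : x' * x = 1) (yV : y' * y = 1).

(** l is the Laurent expansion of e in the variables X and Y: multiplied by a
    power of X Y, both come from the same element of P, thought of as a
    polynomial.  This is a relation because X and Y need not be invertible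
    in E. *)
Definition expands (e : E) (l : C) : Prop :=
  exists (N : nat) (p : P), (a * b) ^+ N * e = evE p /\ (x * y) ^+ N * l = evC p.

Let evE_mon N p : evE ((X * Y) ^+ N * p) = (a * b) ^+ N * evE p.
Proof. by rewrite rmorphM rmorphXn rmorphM. Qed.

Let evC_mon N p : evC ((X * Y) ^+ N * p) = (x * y) ^+ N * evC p.
Proof. by rewrite rmorphM rmorphXn rmorphM. Qed.

(** By algebraic independence in E, two expansions of one element come from the
    same polynomial up to a power of X Y, and this power can be cancelled in C. *)
Lemma expands_unique e l1 l2 : expands e l1 -> expands e l2 -> l1 = l2.
Proof.
move=> [N1 [p1 [E1 C1]]] [N2 [p2 [E2 C2]]].
have pp : (X * Y) ^+ N2 * p1 - (X * Y) ^+ N1 * p2 = 0.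
  by apply: evE_inj; rewrite rmorphB !evE_mon -E1 -E2 mulrCA subrr.
have xyV : (x' * y') ^+ (N1 + N2) * (x * y) ^+ (N1 + N2) = 1.
  by rewrite -exprMn mulrACA xV yV mulr1 expr1n.
have : (x * y) ^+ (N1 + N2) * l1 = (x * y) ^+ (N1 + N2) * l2.
  have /(congr1 evC) := pp.
  rewrite rmorphB !evC_mon -C1 -C2 rmorph0 !mulrA -!exprD addnC.
  by move/subr0_eq.
move/(congr1 ( *%R ((x' * y') ^+ (N1 + N2)))).
by rewrite !mulrA xyV !mul1r.
Qed.

Lemma expands_scalar s : expands s%:A s%:A.
Proof. by exists 0, (cst s); rewrite !expr0 !mul1r evE_cst evC_cst. Qed.

Lemma expandsX : expands a x.
Proof. by exists 0, X; rewrite !expr0 !mul1r. Qed.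

Lemma expandsY : expands b y.
Proof. by exists 0, Y; rewrite !expr0 !mul1r. Qed.

Lemma expandsD e1 e2 l1 l2 :
  expands e1 l1 -> expands e2 l2 -> expands (e1 + e2) (l1 + l2).
Proof.
move=> [N1 [p1 [E1 C1]]] [N2 [p2 [E2 C2]]].
exists (N1 + N2)%N, ((X * Y) ^+ N2 * p1 + (X * Y) ^+ N1 * p2).
by rewrite !rmorphD !evE_mon !evC_mon -E1 -E2 -C1 -C2 !exprD; split; ring.
Qed.

Lemma expandsM e1 e2 l1 l2 :
  expands e1 l1 -> expands e2 l2 -> expands (e1 * e2) (l1 * l2).
Proof.
move=> [N1 [p1 [E1 C1]]] [N2 [p2 [E2 C2]]].
exists (N1 + N2)%N, (p1 * p2).
by rewrite !rmorphM -E1 -E2 -C1 -C2 !exprD; split; ring.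
Qed.

Lemma expands_divX e l : expands (a * e) l -> expands e (x' * l).
Proof.
move=> [N [p [E1 C1]]]; exists N.+1, (Y * p).
rewrite !rmorphM -E1 -C1 !exprS; split; first by ring.
transitivity (x' * x * (y * ((x * y) ^+ N * l))); first by ring.
by rewrite xV mul1r.
Qed.

Lemma expands_divY e l : expands (b * e) l -> expands e (y' * l).
Proof.
move=> [N [p [E1 C1]]]; exists N.+1, (X * p).
rewrite !rmorphM -E1 -C1 !exprS; split; first by ring.
transitivity (y' * y * (x * ((x * y) ^+ N * l))); first by ring.
by rewrite yV mul1r.
Qed.

End LaurentExpansion.

Section Evaluation.
Variables (S : comNzRingType).

Lemma eval2_double_sum (E : comAlgType S) (a b : E) P :
  eval2 a b P = \sum_(k < size P) \sum_(i < size P`_k) P`_k`_i *: (a ^+ i * b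
    ^+ k).
Proof.
rewrite eval2_sum; apply: eq_bigr => k _.
have le_size : (size (map_poly (in_alg E) (P`_k)%R) <= size (P`_k)%R)%N.
  by apply/leq_sizeP => i le_i; rewrite coef_map nth_default // /= scale0r.
rewrite eval2_polyC (horner_coef_wide _ le_size) mulr_suml.
by apply: eq_bigr => i _; rewrite coef_map /= -mulrA mulr_algl.
Qed.

Lemma eval2_lrmorph (E C : comAlgType S) (h : {lrmorphism E -> C}) (a b : E) P :
  h (eval2 a b P) = eval2 (h a) (h b) P.
Proof.
rewrite !eval2_double_sum raddf_sum; apply: eq_bigr => k _ /=.
rewrite raddf_sum; apply: eq_bigr => i _ /=.
by rewrite linearZ rmorphM !rmorphXn.
Qed.

End Evaluation.

Section LaurentIndependence.
Variables (S : comNzRingType) (C : comAlgType S) (mon : int -> int -> C).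
Variable slice : int -> int -> {scalar C}.
Hypotheses (mon0 : mon 0 0 = 1)
  (monD : forall i j k l, mon i j * mon k l = mon (i + k) (j + l))
  (slice_mon : forall i j k l, slice i j (mon k l) = ((k, l) == (i, j))%:R).
Variables (s0 s1 t0 t1 : S).
Hypotheses (ts0 : t0 * s0 = 1) (ts1 : t1 * s1 = 1).

Lemma alg_indep2_mon : alg_indep2 (s0 *: mon 1 0) (s1 *: mon 0 1).
Proof.
move=> P P0; apply/polyP => k; apply/polyP => i; rewrite !coef0.
case: (ltnP k (size P)) => kP; last by rewrite (nth_default _ kP) coef0.
case: (ltnP i (size P`_k)) => iP; last by rewrite nth_default.
have : slice i%:Z k%:Z (eval2 (s0 *: mon 1 0) (s1 *: mon 0 1) P) = 0.
  by rewrite P0 raddf0.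
have term k' i' c : slice i%:Z k%:Z (c *: ((s0 *: mon 1 0) ^+ i' *
    (s1 *: mon 0 1) ^+ k')) =
    (c * s0 ^+ i' * s1 ^+ k') * ((i' == i) && (k' == k))%:R.
  rewrite !exprZn -scalerAl -scalerAr !scalerA !(monXn mon0 monD) monD scalarZ.
  by rewrite slice_mon !mul0r !mul1r addr0 add0r.
rewrite eval2_double_sum raddf_sum (bigD1 (Ordinal kP)) //= [X in _ + X]big1;
  last first.
  move=> k' /negbTE kk'; rewrite raddf_sum big1 // => i' _ /=.
  by rewrite term -[(k' : nat) == k]/(k' == Ordinal kP) kk' andbF mulr0.
rewrite addr0 raddf_sum (bigD1 (Ordinal iP)) //= big1 => [|i' /negbTE ii'].
  rewrite addr0 term !eqxx mulr1 => /(congr1 ( *%R (t0 ^+ i * t1 ^+ k))).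
  rewrite mulr0 => e.
  transitivity ((t0 * s0) ^+ i * (t1 * s1) ^+ k * P`_k`_i).
    by rewrite ts0 ts1 !expr1n !mul1r.
  by rewrite -[RHS]e !exprMn; ring.
by rewrite term -[(i' : nat) == i]/(i' == Ordinal iP) ii' mulr0.
Qed.

End LaurentIndependence.

(** * Group rings as algebras over smaller group rings *)

Section GroupRings.
Variable G : zmodType.
Implicit Types (r s : group_ring G) (g h : G).

Lemma gr_sumE r :
  r = \sum_(g <- monalg.msupp r) gr_exp g *~ monalg.mcoeff g r.
Proof.
rewrite [LHS]monalg.monalgE; apply: eq_bigr => g _.
case: (monalg.mcoeff g r) => n.
  by rewrite -[X in monalg.mkmalgU g X]natz monalg.monalgUMn.
by rewrite NegzE mulrNz -[X in - X]natz monalg.monalgUN monalg.monalgUMn.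
Qed.

Lemma gr_additive_ext (A : zmodType) (f f' : {additive group_ring G -> A}) :
  (forall g, f (gr_exp g) = f' (gr_exp g)) -> f =1 f'.
Proof.
move=> ff r; rewrite (gr_sumE r) !raddf_sum; apply: eq_bigr => g _.
by rewrite !raddfMz ff.
Qed.

Lemma gr_expK g : gr_exp (- g) * gr_exp g = 1.
Proof. by rewrite -gr_expD addNr. Qed.

Lemma gr_nonneg0 : gr_nonneg (0 : group_ring G).
Proof. by move=> g; rewrite monalg.mcoeff0. Qed.

Lemma gr_nonneg_exp g : gr_nonneg (gr_exp g).
Proof. by move=> h; rewrite monalg.mcoeffU mulrn_wge0. Qed.

Lemma gr_nonneg1 : gr_nonneg (1 : group_ring G).
Proof. exact: gr_nonneg_exp. Qed.

Lemma gr_nonnegD r s : gr_nonneg r -> gr_nonneg s -> gr_nonneg (r + s).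
Proof. by move=> r0 s0 g; rewrite monalg.mcoeffD addr_ge0. Qed.

Lemma gr_nonneg_sum (I : Type) (c : seq I) (P : pred I) (F : I -> group_ring G) :
  (forall i, P i -> gr_nonneg (F i)) -> gr_nonneg (\sum_(i <- c | P i) F i).
Proof.
move=> F0; elim/big_ind: _ => //; [exact: gr_nonneg0 | exact: gr_nonnegD].
Qed.

Lemma gr_nonnegM r s : gr_nonneg r -> gr_nonneg s -> gr_nonneg (r * s).
Proof.
move=> r0 s0; rewrite [r * s]/(gr_mul r s); apply: gr_nonneg_sum => g _.
apply: gr_nonneg_sum => h _ k.
by rewrite monalg.mcoeffU mulrn_wge0 // mulr_ge0 // ?r0 ?s0.
Qed.

Lemma gr_nonneg_mul_exp r g : gr_nonneg (r * gr_exp g) -> gr_nonneg r.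
Proof.
move=> rg; rewrite -[r]mulr1 -(gr_expK g) [gr_exp (- g) * _]mulrC mulrA.
exact/gr_nonnegM/gr_nonneg_exp.
Qed.

End GroupRings.

Section GroupRingMaps.
Variables (G H : zmodType) (phi : {additive G -> H}).

Definition gr_map : group_ring G -> group_ring H :=
  gr_lift (fun g => gr_exp (phi g)).

Fact gr_map_is_zmod_morphism : zmod_morphism gr_map.
Proof. exact: gr_lift_is_additive. Qed.

Fact gr_map_is_monoid_morphism : monoid_morphism gr_map.
Proof.
apply: gr_lift_is_monoid_morphism => [|g h]; first by rewrite raddf0.
by rewrite raddfD gr_expD.
Qed.

HB.instance Definition _ := GRing.isZmodMorphism.Build _ _ gr_map
  gr_map_is_zmod_morphism.
HB.instance Definition _ := GRing.isMonoidMorphism.Build _ _ gr_map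
  gr_map_is_monoid_morphism.

Lemma gr_map_exp g : gr_map (gr_exp g) = gr_exp (phi g).
Proof. by rewrite /gr_map /gr_lift monalg.mmapU mul1r. Qed.

End GroupRingMaps.

Section GroupRingAlgebra.
Variables (V G W : zmodType) (inV : {additive V -> G}).
Variables (prV : {additive G -> V}) (prW : {additive G -> W}).
Hypotheses (prVK : cancel inV prV) (prW0 : forall v, prW (inV v) = 0).

(** The ring Z[G] as an algebra over Z[V]; the morphism V -> G that makes it one is
    kept in the type. *)
Definition group_algebra (phi : {additive V -> G}) : Type := group_ring G.
Local Notation A := (group_algebra inV).

HB.instance Definition _ phi := GRing.ComNzRing.on (group_algebra phi).

Definition gr_scale phi (s : group_ring V) (x : group_algebra phi) :
  group_algebra phi :=
  gr_map phi s * x.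

Fact gr_scaleA phi s t (x : group_algebra phi) :
  gr_scale s (gr_scale t x) = gr_scale (s * t) x.
Proof. by rewrite /gr_scale rmorphM mulrA. Qed.

Fact gr_scale1 phi : left_id 1 (@gr_scale phi).
Proof. by move=> x; rewrite /gr_scale rmorph1 mul1r. Qed.

Fact gr_scaleDr phi : right_distributive (@gr_scale phi) +%R.
Proof. by move=> s x y; exact: mulrDr. Qed.

Fact gr_scaleDl phi (x : group_algebra phi) :
  {morph (@gr_scale phi)^~ x : s t / s + t}.
Proof. by move=> s t; rewrite /gr_scale rmorphD mulrDl. Qed.

HB.instance Definition _ phi := GRing.Zmodule_isLmodule.Build (group_ring V)
  (group_algebra phi) (@gr_scaleA phi) (@gr_scale1 phi) (@gr_scaleDr phi)
    (@gr_scaleDl phi).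

Fact gr_scaleAl phi (s : group_ring V) (x y : group_algebra phi) :
  s *: (x * y) = (s *: x) * y.
Proof. exact: mulrA. Qed.

HB.instance Definition _ phi := GRing.Lmodule_isLalgebra.Build (group_ring V)
  (group_algebra phi) (@gr_scaleAl phi).
HB.instance Definition _ phi := GRing.Lalgebra_isComAlgebra.Build (group_ring V)
  (group_algebra phi).

Lemma group_algebra_scaleE s (x : A) : s *: x = gr_map inV s * x.
Proof. by []. Qed.

(** When G is the direct sum of V and W, elements of Z[G] are combinations of
    elements of W with coefficients in Z[V]; this is the coefficient of w. *)
Definition gr_slice (w : W) : A -> group_ring V :=
  monalg.mmap intr (fun g => if prW g == w then gr_exp (prV g) else 0).

Fact gr_slice_is_zmod_morphism w : zmod_morphism (gr_slice w).
Proof. by move=> r s; exact: monalg.mmapB. Qed.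

HB.instance Definition _ w := GRing.isZmodMorphism.Build _ _
  (gr_slice w) (gr_slice_is_zmod_morphism w).

Lemma gr_slice_exp w g :
  gr_slice w (gr_exp g) = if prW g == w then gr_exp (prV g) else 0.
Proof. by rewrite /gr_slice monalg.mmapU mul1r. Qed.

Let slice_exp w v (x : A) : gr_slice w (gr_exp v *: x) = gr_exp v * gr_slice w x.
Proof.
rewrite [x]gr_sumE scaler_sumr !raddf_sum mulr_sumr.
apply: eq_bigr => g _; rewrite -scalerMzr !raddfMz mulrzAr group_algebra_scaleE.
rewrite gr_map_exp -gr_expD /= !gr_slice_exp !raddfD prW0 add0r prVK.
by case: ifP => _; rewrite ?mulr0 ?gr_expD.
Qed.

Fact gr_slice_is_scalable w : scalable_for *%R (gr_slice w).
Proof.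
move=> s x; rewrite (gr_sumE s) scaler_suml mulr_suml raddf_sum.
apply: eq_bigr => v _.
by rewrite -scalerMzl mulrzAl raddfMz /= slice_exp.
Qed.

HB.instance Definition _ w := GRing.isScalable.Build (group_ring V) A
  (group_ring V) *%R (gr_slice w) (@gr_slice_is_scalable w).

Lemma gr_slice_exists : exists slice : W -> {scalar A}, forall w g,
  slice w (gr_exp g) = if prW g == w then gr_exp (prV g) else 0.
Proof. by exists (fun w => gr_slice w : {scalar A}) => w g;
  exact: gr_slice_exp. Qed.

End GroupRingAlgebra.

(** * The cluster variables of the Kronecker quiver *)

Section FrozenMonomials.
Variables n m : nat.

Lemma frozen_monomialD (v w : 'rV[int]_m) :
  frozen_monomial n (v + w) = frozen_monomial n v * frozen_monomial n w.
Proof.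
rewrite -big_split; apply: eq_bigr => i _.
by rewrite mxE expfzDr // initial_var_neq0.
Qed.

Lemma frozen_monomial0 : frozen_monomial n (0 : 'rV[int]_m) = 1.
Proof. by apply: big1 => i _; rewrite mxE expr0z. Qed.

Lemma frozen_monomialNK (v : 'rV[int]_m) :
  frozen_monomial n (- v) * frozen_monomial n v = 1.
Proof. by rewrite -frozen_monomialD addNr frozen_monomial0. Qed.

Lemma coef_embedding_exp (v : 'rV[int]_m) :
  coef_embedding n (gr_exp v) = frozen_monomial n v.
Proof. by rewrite /coef_embedding /gr_lift monalg.mmapU mul1r. Qed.

(** Fractions of polynomials that are positive at (1, .., 1) are closed under all
    operations but subtraction, and nonzero: cluster variables are among them and
    may be divided by. *)
Definition subtraction_free (x : ambient_field n m) : Prop :=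
  exists a b : mpoly (n + m) rat,
    [/\ 0 < meval (fun=> 1) a, 0 < meval (fun=> 1) b
      & x = @tofrac (mpoly (n + m) rat) a / @tofrac (mpoly (n + m) rat) b].

Let meval_neq0 (a : mpoly (n + m) rat) :
  0 < meval (fun=> 1) a -> @tofrac (mpoly (n + m) rat) a != 0.
Proof. by rewrite tofrac_eq0; apply: contraTneq => ->; rewrite meval0 ltxx. Qed.

Lemma subtraction_free_neq0 x : subtraction_free x -> x != 0.
Proof.
by move=> [a [b [a0 b0 ->]]]; rewrite mulf_neq0 ?invr_eq0 ?meval_neq0.
Qed.

Lemma subtraction_free_var i : subtraction_free (initial_var i).
Proof.
exists (mpolyX _ (mnm1 i)), 1.
by rewrite mevalXU meval1 rmorph1 divr1 ltr01.
Qed.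

Lemma subtraction_freeD x y :
  subtraction_free x -> subtraction_free y -> subtraction_free (x + y).
Proof.
move=> [a [b [a0 b0 ->]]] [c [d [c0 d0 ->]]].
exists (a * d + c * b), (b * d); split.
- by rewrite mevalD !mevalM addr_gt0 ?mulr_gt0.
- by rewrite mevalM mulr_gt0.
by rewrite rmorphD !rmorphM addf_div ?meval_neq0.
Qed.

Lemma subtraction_freeM x y :
  subtraction_free x -> subtraction_free y -> subtraction_free (x * y).
Proof.
move=> [a [b [a0 b0 ->]]] [c [d [c0 d0 ->]]].
exists (a * c), (b * d); rewrite !mevalM !mulr_gt0 //.
by rewrite !rmorphM mulf_div.
Qed.

Lemma subtraction_freeV x : subtraction_free x -> subtraction_free x^-1.
Proof. by move=> [a [b [a0 b0 ->]]]; exists b, a; rewrite invf_div. Qed.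

Lemma subtraction_free1 : subtraction_free 1.
Proof. by exists 1, 1; rewrite meval1 rmorph1 divr1 ltr01. Qed.

Lemma subtraction_freeXn x k : subtraction_free x -> subtraction_free (x ^+ k).
Proof.
move=> x0; elim: k => [|k IH]; first exact: subtraction_free1.
by rewrite exprS; apply: subtraction_freeM.
Qed.

Lemma subtraction_free_frozen v : subtraction_free (frozen_monomial n v).
Proof.
apply: big_ind => [||i _]; [exact: subtraction_free1|exact: subtraction_freeM|].
case: (v 0 i) => k; first exact/subtraction_freeXn/subtraction_free_var.
by rewrite NegzE -exprnN; apply/subtraction_freeV/subtraction_freeXn/subtraction_free_var.
Qed.

End FrozenMonomials.

Local Notation K := (ambient_field 2 2).
Local Notation F v := (frozen_monomial 2 v).

Definition pos_part (v : 'rV[int]_2) : 'rV[int]_2 := map_mx (Num.max 0) v.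

Definition delta_exponent (k : int) : 'rV[int]_2 := \row_i (k + i%:Z).

Definition line_exponent (k : int) : 'rV[int]_2 := \row_i Num.min k (i%:Z + 1).

(** The exponent of y in the square of the factor that rescales x_k.  Up to sign it
    also records the arrows between mutable and frozen vertices, see
    at_position.  It is linear in k but for breaks at k = 1 and k = 2. *)
Definition g_exponent (k : int) : 'rV[int]_2 :=
  line_exponent k *+ 2 - delta_exponent k.

(** This is the rule by which mutation changes the arrows at frozen vertices. *)
Lemma g_exponent_exchange k :
  g_exponent (k - 1) + g_exponent (k + 1) = - pos_part (- g_exponent k) *+ 2.
Proof. by apply/rowP => i; rewrite !mxE; lia. Qed.

(** The cluster variables up to monomials in y, normalised such that they satisfy
    a recurrence with constant coefficients. *)
Definition linear_var : int -> K :=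
  linear_seq (kronecker_y1 * kronecker_y2) kronecker_u
    (kronecker_y1 * kronecker_y2)^-1 kronecker_x1
    (kronecker_y1 * kronecker_y2 * kronecker_x2).

(** The cluster variable x_k, with x_0 and x_1 in the initial seed. *)
Definition line_var (k : int) : K := F (- line_exponent k) * linear_var k.

Lemma kronecker_y_neq0 : kronecker_y1 * kronecker_y2 != 0.
Proof. by rewrite mulf_neq0 // initial_var_neq0. Qed.

Lemma linear_varP :
  linear_rec (kronecker_y1 * kronecker_y2) kronecker_u linear_var.
Proof. by apply: linear_seqP; rewrite mulVf // kronecker_y_neq0. Qed.

Lemma delta_exponentS k : delta_exponent (k + 1) = const_mx 1 + delta_exponent k.
Proof. by apply/rowP => i; rewrite !mxE; lia. Qed.

Lemma frozen_const1 : F (const_mx 1) = kronecker_y1 * kronecker_y2.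
Proof.
rewrite /frozen_monomial big_ord_recl big_ord1 !mxE !expr1z.
by congr (_ * initial_var (rshift _ _)); apply: val_inj.
Qed.

Lemma frozen_deltaS k :
  F (delta_exponent (k + 1)) = kronecker_y1 * kronecker_y2 * F (delta_exponent k).
Proof.
by rewrite delta_exponentS frozen_monomialD frozen_const1.
Qed.

Lemma initial_defect (L : fieldType) (x1 x2 y1 y2 : L) : x1 != 0 -> x2 != 0 ->
  (x1 ^+ 2 + y1 * y2 * x2 ^+ 2 + y2) / (x1 * x2) * x1 * (y1 * y2 * x2)
    - y1 * y2 * x1 ^+ 2 - (y1 * y2 * x2) ^+ 2 = y1 * y2 ^+ 2.
Proof. by move=> x1_neq0 x2_neq0; field; rewrite ?x1_neq0 ?x2_neq0. Qed.

Lemma rec_defect_linear_var k :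
  rec_defect (kronecker_y1 * kronecker_y2) kronecker_u linear_var k =
  F (delta_exponent k).
Proof.
have d0 : rec_defect (kronecker_y1 * kronecker_y2) kronecker_u linear_var 1 =
    F (delta_exponent 1).
  have v0 : linear_var 0 = kronecker_x1 by [].
  have v1 : linear_var 1 = kronecker_y1 * kronecker_y2 * kronecker_x2 by [].
  rewrite /rec_defect subrr v0 v1.
  have -> : F (delta_exponent 1) = kronecker_y1 * kronecker_y2 ^+ 2.
    rewrite /frozen_monomial big_ord_recl big_ord1 !mxE /= expr1z.
    congr (_ * initial_var (rshift _ _) ^+ _); exact: val_inj.
  by apply: initial_defect; exact: initial_var_neq0.
have y0 := kronecker_y_neq0.
have dS k' : (rec_defect (kronecker_y1 * kronecker_y2) kronecker_u linear_var k' =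
    F (delta_exponent k')) <->
    (rec_defect (kronecker_y1 * kronecker_y2) kronecker_u linear_var (k' + 1) =
    F (delta_exponent (k' + 1))).
  by rewrite (rec_defectS linear_varP) frozen_deltaS; split=> [->//|/(mulfI y0)].
move: k; apply: (@int_ind2 _ 1) => [||k _|k _] //.
- exact: (proj1 (dS 1)).
- exact: (proj1 (dS k)).
by move=> dk; apply: (proj2 (dS (k - 1))); rewrite subrK.
Qed.

Lemma linear_var_exchange k :
  linear_var (k - 1) * linear_var (k + 1) =
  linear_var k ^+ 2 + F (delta_exponent k).
Proof. by rewrite (rec_exchange linear_varP) rec_defect_linear_var. Qed.

Lemma line_var_exchange k :
  line_var (k - 1) * line_var (k + 1) =
  F (pos_part (g_exponent k)) * line_var k ^+ 2 + F (pos_part (- g_exponent k)).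
Proof.
rewrite /line_var mulrACA linear_var_exchange mulrDr exprMn [F _ ^+ 2]expr2.
rewrite !mulrA -!frozen_monomialD.
by congr (F _ * _ * _ + F _); apply/rowP => i; rewrite !mxE; lia.
Qed.

Lemma line_var0 : line_var 0 = kronecker_x1.
Proof.
rewrite /line_var; have -> : - line_exponent 0 = 0.
  by apply/rowP => i; rewrite !mxE; lia.
by rewrite frozen_monomial0 mul1r.
Qed.

Lemma line_var1 : line_var 1 = kronecker_x2.
Proof.
rewrite /line_var.
have -> : linear_var 1 = kronecker_y1 * kronecker_y2 * kronecker_x2 by [].
have -> : - line_exponent 1 = delta_exponent 0 - delta_exponent 1.
  by apply/rowP => i; rewrite !mxE; lia.
rewrite frozen_monomialD [F (delta_exponent 0) * _]mulrC -[LHS]mulrA.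
rewrite [F (delta_exponent 0) * _]mulrA [F (delta_exponent 0) * _]mulrC.
by rewrite -frozen_deltaS add0r mulrA frozen_monomialNK mul1r.
Qed.

Lemma line_var_free k : subtraction_free (line_var k).
Proof.
have step k1 k2 k' : line_var k1 * line_var k2 = F (pos_part (g_exponent k')) *
    line_var k' ^+ 2 + F (pos_part (- g_exponent k')) ->
    subtraction_free (line_var k1) -> subtraction_free (line_var k') ->
    subtraction_free (line_var k2).
  move=> exch f1 f'; have -> : line_var k2 = (line_var k1 * line_var k2) /
    line_var k1.
    by rewrite mulrAC divff ?mul1r // subtraction_free_neq0.
  rewrite exch; apply/subtraction_freeM/subtraction_freeV => //.
  apply: subtraction_freeD; last exact: subtraction_free_frozen.
  apply: subtraction_freeM; first exact: subtraction_free_frozen.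
  exact: subtraction_freeXn.
move: k; apply: (@int_ind2 _ 0) => [||k|k].
- by rewrite line_var0; apply: subtraction_free_var.
- by rewrite line_var1; apply: subtraction_free_var.
- exact/step/line_var_exchange.
- by apply: step; rewrite mulrC line_var_exchange.
Qed.

(** * The seeds of the Kronecker quiver *)

Lemma big_ord2_pair (R : Type) (idx : R) (op : Monoid.com_law idx) (l h : 'I_2)
    (f : 'I_2 -> R) :
  l != h -> \big[op/idx]_(i < 2) f i = op (f l) (f h).
Proof.
move=> lh; rewrite (bigD1 l) //= (bigD1 h) 1?eq_sym //= big1 ?Monoid.mulm1 //.
by move=> i; case: l lh => -[|[|]] //; case: h => -[|[|]] //; case: i => -[|[|]].
Qed.

Lemma ord2_pairP (l h i : 'I_2) : l != h -> i = l \/ i = h.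
Proof.
by case: l h i => -[|[|?]] // ? [[|[|?]] // ?] [[|[|?]] // ?] // _;
  (by left; apply: val_inj) || (by right; apply: val_inj).
Qed.

(** The shape of all seeds, where arrows between frozen vertices are left out.
    The exchange graph is a line: mutation at l, the vertex of x_p, leads to the
    cluster {x_(p+1), x_(p+2)}, and mutation at h to {x_(p-1), x_p}. *)
Record at_position (p : int) (l h : 'I_2) (s : seed 2 2) : Prop := AtPosition {
  pos_neq : l != h;
  pos_varl : seed_var s (lshift 2 l) = line_var p;
  pos_varh : seed_var s (lshift 2 h) = line_var (p + 1);
  pos_varf : forall f, seed_var s (rshift 2 f) = initial_var (rshift 2 f);
  pos_ll : seed_quiver s (lshift 2 l) (lshift 2 l) = 0;
  pos_hh : seed_quiver s (lshift 2 h) (lshift 2 h) = 0;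
  pos_lh : seed_quiver s (lshift 2 l) (lshift 2 h) = 2;
  pos_hl : seed_quiver s (lshift 2 h) (lshift 2 l) = - 2;
  pos_lf : forall f, seed_quiver s (lshift 2 l) (rshift 2 f) =
    g_exponent (p + 1) 0 f;
  pos_fl : forall f, seed_quiver s (rshift 2 f) (lshift 2 l) = - g_exponent (p
    + 1) 0 f;
  pos_hf : forall f, seed_quiver s (lshift 2 h) (rshift 2 f) = - g_exponent p 0 f;
  pos_fh : forall f, seed_quiver s (rshift 2 f) (lshift 2 h) = g_exponent p 0 f }.

Lemma initial_at_position : at_position 0 ord0 ord_max (initial_seed kronecker).
Proof.
split=> //; rewrite ?line_var0 ?line_var1 //= ?/kronecker ?mxE //.
all: by move=> f; rewrite !mxE; case: f => -[|[|]].
Qed.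

Lemma arrowsE (Q : ice_quiver 2 2) i j : (arrows Q i j)%:Z = Num.max 0 (Q i j).
Proof. by rewrite /arrows; case: ifP; lia. Qed.

Lemma prod_frozen_arrows (e : 'I_2 -> nat) (v : 'rV[int]_2) :
  (forall f, (e f)%:Z = v 0 f) ->
  \prod_(f < 2) (initial_var (rshift 2 f) : K) ^+ e f = F v.
Proof. by move=> ev; apply: eq_bigr => f _; rewrite -ev. Qed.

Lemma prod_seed_vars (s : seed 2 2) (l h : 'I_2) (e : 'I_(2 + 2) -> nat)
    (v : 'rV[int]_2) :
  l != h -> (forall f, seed_var s (rshift 2 f) = initial_var (rshift 2 f)) ->
  (forall f, (e (rshift 2 f))%:Z = v 0 f) ->
  \prod_i seed_var s i ^+ e i =
  seed_var s (lshift 2 l) ^+ e (lshift 2 l) *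
  seed_var s (lshift 2 h) ^+ e (lshift 2 h) * F v.
Proof.
move=> lh sf ev; rewrite big_split_ord /= (big_ord2_pair _ _ lh) /=;
  congr (_ * _).
by rewrite -(prod_frozen_arrows ev); apply: eq_bigr => f _; rewrite sf.
Qed.

Lemma arrows_eq (Q : ice_quiver 2 2) i j (c : int) :
  Q i j = c -> arrows Q i j = if 0 <= c then `|c|%N else 0%N.
Proof. by move=> <-. Qed.

Lemma mutate_quiver_at (Q : ice_quiver 2 2) k i j :
  (i == k) || (j == k) -> mutate_quiver k Q i j = - Q i j.
Proof. by move=> ijk; rewrite mxE ijk. Qed.

Lemma mutate_quiver_off (Q : ice_quiver 2 2) k i j :
  i != k -> j != k -> mutate_quiver k Q i j =
    Q i j + Num.max 0 (Q i k) * Num.max 0 (Q k j)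
          - Num.max 0 (Q j k) * Num.max 0 (Q k i).
Proof.
by move=> /negbTE ik /negbTE jk; rewrite mxE ik jk /= !PoszM !arrowsE.
Qed.

Lemma g_exponent_next p f : g_exponent (p + 1) 0 f =
  - g_exponent (p - 1) 0 f - 2 * Num.max 0 (- g_exponent p 0 f).
Proof. by have /rowP/(_ f) := g_exponent_exchange p; rewrite !mxE; lia. Qed.

Lemma lshift_neq (l h : 'I_2) : l != h -> lshift 2 l != lshift 2 h.
Proof. by rewrite eq_lshift. Qed.

Lemma rshift_neq (f i : 'I_2) : rshift 2 f != lshift 2 i :> 'I_(2 + 2).
Proof. by apply/eqP => /(congr1 val) /=; case: i => i /=; lia. Qed.

Lemma pos_partE v f : pos_part v 0 f = Num.max 0 (v 0 f).
Proof. by rewrite mxE. Qed.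

Lemma pos_partNE v f : pos_part (- v) 0 f = Num.max 0 (- v 0 f).
Proof. by rewrite !mxE. Qed.

Lemma mutate_low p l h s :
  at_position p l h s -> at_position (p + 1) h l (mutate (lshift 2 l) s).
Proof.
case=> lh sl sh sf ll hh elh ehl lf fl hf fh.
have hl : h != l by rewrite eq_sym.
have hl' := lshift_neq hl.
have gS f := g_exponent_next (p + 1) f.
split=> //=; rewrite ?eqxx ?(negbTE hl') //.
- rewrite (@prod_seed_vars s l h _ (pos_part (g_exponent (p + 1)))) //;
  last first.
    by move=> f; rewrite arrowsE lf pos_partE.
  rewrite (@prod_seed_vars s l h _ (pos_part (- g_exponent (p + 1)))) //;
    last first.
    by move=> f; rewrite arrowsE fl pos_partNE.
  rewrite (arrows_eq ll) (arrows_eq elh) (arrows_eq ehl) /= sl sh.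
  rewrite !expr0 !mul1r [_ ^+ 2 * _]mulrC -line_var_exchange addrK mulrAC.
  rewrite divff ?mul1r //.
  exact/subtraction_free_neq0/line_var_free.
- by move=> f; rewrite (negbTE (rshift_neq f l)).
- by rewrite mutate_quiver_off // hh ehl elh.
- by rewrite mutate_quiver_at ?eqxx // ll oppr0.
- by rewrite mutate_quiver_at ?eqxx ?orbT // ehl.
- by rewrite mutate_quiver_at ?eqxx // elh.
- move=> f; rewrite mutate_quiver_off ?rshift_neq // gS addrK hf ehl lf fl elh.
  by lia.
- move=> f; rewrite mutate_quiver_off ?rshift_neq // gS addrK fh fl elh ehl lf.
  by lia.
- by move=> f; rewrite mutate_quiver_at ?eqxx // lf.
- by move=> f; rewrite mutate_quiver_at ?eqxx ?orbT // fl opprK.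
Qed.

Lemma mutate_high p l h s :
  at_position p l h s -> at_position (p - 1) h l (mutate (lshift 2 h) s).
Proof.
case=> lh sl sh sf ll hh elh ehl lf fl hf fh.
have hl : h != l by rewrite eq_sym.
have lh' := lshift_neq lh.
have gS f := g_exponent_next p f.
split=> //=; rewrite ?eqxx ?(negbTE lh') ?subrK //.
- rewrite (@prod_seed_vars s h l _ (pos_part (- g_exponent p))) //; last first.
    by move=> f; rewrite arrowsE hf pos_partNE.
  rewrite (@prod_seed_vars s h l _ (pos_part (g_exponent p))) //; last first.
    by move=> f; rewrite arrowsE fh pos_partE.
  rewrite (arrows_eq hh) (arrows_eq elh) (arrows_eq ehl) /= sl sh.
  rewrite !expr0 !mul1r addrC [_ ^+ 2 * _]mulrC -line_var_exchange.
  by rewrite mulfK //; exact/subtraction_free_neq0/line_var_free.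
- by move=> f; rewrite (negbTE (rshift_neq f h)).
- by rewrite mutate_quiver_at ?eqxx // hh oppr0.
- by rewrite mutate_quiver_off // ll ehl elh.
- by rewrite mutate_quiver_at ?eqxx // ehl opprK.
- by rewrite mutate_quiver_at ?eqxx ?orbT // elh.
- by move=> f; rewrite mutate_quiver_at ?eqxx // hf opprK.
- by move=> f; rewrite mutate_quiver_at ?eqxx ?orbT // fh.
- move=> f; rewrite mutate_quiver_off ?rshift_neq // lf elh hf fh ehl gS.
  by rewrite [Num.max 0 2]/(2 : int) [Num.max 0 (- 2)]/(0 : int); ring.
- move=> f; rewrite mutate_quiver_off ?rshift_neq // fl fh ehl elh hf gS.
  by rewrite [Num.max 0 2]/(2 : int) [Num.max 0 (- 2)]/(0 : int); ring.
Qed.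

Lemma seed_at_rcons w i :
  seed_at kronecker (rcons w i) = mutate (lshift 2 i) (seed_at kronecker w).
Proof. by rewrite /seed_at foldl_rcons. Qed.

Lemma position_of_word w : exists p l h, at_position p l h (seed_at kronecker w).
Proof.
elim/last_ind: w => [|w i [p [l [h wp]]]].
  by exists 0, ord0, ord_max; exact: initial_at_position.
rewrite seed_at_rcons; case: (ord2_pairP i (pos_neq wp)) => ->.
  by exists (p + 1), h, l; exact: mutate_low.
by exists (p - 1), h, l; exact: mutate_high.
Qed.

Lemma word_of_position p : exists w l h, at_position p l h (seed_at kronecker w).
Proof.
move: p; apply: (@int_ind2 _ 0) => [||k _ [w [l [h wp]]]|k _ [w [l [h wp]]]].
- by exists [::], ord0, ord_max; exact: initial_at_position.
- exists [:: ord0], ord_max, ord0; exact: mutate_low initial_at_position.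
- by exists (rcons w l), h, l; rewrite seed_at_rcons; exact: mutate_low.
- by exists (rcons w h), h, l; rewrite seed_at_rcons; exact: mutate_high.
Qed.

(** * The Laurent phenomenon and a Laurent ring for the extended algebra *)

Section LaurentEmbedding.
Variables n m : nat.

Definition laurent_monomial (v : 'rV[int]_(n + m)) : ambient_field n m :=
  \prod_i initial_var i ^ v 0 i.

Definition laurent_embedding : ZP (n + m) -> ambient_field n m :=
  gr_lift laurent_monomial.

Lemma laurent_monomial0 : laurent_monomial 0 = 1.
Proof. by apply: big1 => i _; rewrite mxE expr0z. Qed.

Lemma laurent_monomialD :
  {morph laurent_monomial : v w / v + w >-> v * w}.
Proof.
move=> v w; rewrite -big_split; apply: eq_bigr => i _.
by rewrite mxE expfzDr // initial_var_neq0.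
Qed.

Fact laurent_embedding_is_zmod_morphism : zmod_morphism laurent_embedding.
Proof. exact: gr_lift_is_additive. Qed.

Fact laurent_embedding_is_monoid_morphism : monoid_morphism laurent_embedding.
Proof.
exact: gr_lift_is_monoid_morphism laurent_monomial0 laurent_monomialD.
Qed.

HB.instance Definition _ := GRing.isZmodMorphism.Build _ _ laurent_embedding
  laurent_embedding_is_zmod_morphism.
HB.instance Definition _ := GRing.isMonoidMorphism.Build _ _ laurent_embedding
  laurent_embedding_is_monoid_morphism.

Lemma laurent_embedding_exp v : laurent_embedding (gr_exp v) = laurent_monomial v.
Proof. by rewrite /laurent_embedding /gr_lift monalg.mmapU mul1r. Qed.

(** Multiplied by a large power of all variables, a Laurent polynomial becomes a
    polynomial, and distinct monomials in a polynomial ring are independent. *)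
Lemma laurent_embedding_eq0 r : laurent_embedding r = 0 -> r = 0.
Proof.
move=> r0; apply/eqP; apply: contraT => r_neq0.
pose D : seq 'rV[int]_(n + m) := enum_fset (monalg.msupp r).
have D_uniq : uniq D by exact: fset_uniq.
pose N := (\max_(v <- D) \max_i `|v 0%R i|)%N.
have boundN v i : v \in D -> 0 <= v 0 i + N%:Z.
  move=> vD; have : (`|v 0%R i| <= N)%N.
    have le1 := leq_bigmax (F := fun i : 'I_(n + m) => `|v 0%R i|%N) i.
    have le2 := @leq_bigmax_seq _ D xpredT
      (fun w : 'rV[int]_(n + m) => (\max_i `|w 0%R i|)%N) v vD isT.
    exact: leq_trans le1 le2.
  lia.
pose mm (v : 'rV[int]_(n + m)) : 'X_{1..n + m} :=
  [multinom absz (v 0 i + N%:Z)%R | i < n + m].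
have mm_inj : {in D &, injective mm}.
  move=> v w vD wD vw; apply/rowP => i.
  have := congr1 (fun k : 'X_{1..n + m} => k i) vw; rewrite !mnmE => e.
  apply: (addIr N%:Z).
  by rewrite -(gez0_abs (boundN v i vD)) -(gez0_abs (boundN w i wD)) e.
pose P : {mpoly rat[n + m]} :=
  \sum_(v <- D) (monalg.mcoeff v r)%:~R *: 'X_[mm v].
have P0 : P = 0.
  apply/eqP; rewrite -tofrac_eq0; apply/eqP.
  transitivity (laurent_embedding r * laurent_embedding (gr_exp (const_mx N%:Z))).
    rewrite /P raddf_sum [laurent_embedding r]monalg.mmapE mulr_suml.
    apply: eq_big_seq => v vD /=.
    rewrite scaler_int raddfMz mulrzl mulrzAl; congr (_ *~ _).
    rewrite laurent_embedding_exp -laurent_monomialD mpolyXE_id /= rmorph_prod.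
    apply: eq_bigr => i _; rewrite rmorphXn /= mnmE mxE [const_mx _ _ _]mxE.
    by have /gez0_abs <- := boundN v i vD.
  by rewrite r0 mul0r.
have [v vD] : exists v, v \in D.
  apply/fset0Pn/eqP => s0.
  by move: r_neq0; rewrite [r]gr_sumE [monalg.msupp r]s0 big_seq_fset0 eqxx.
have /(congr1 (mcoeff (mm v))) := P0.
rewrite mcoeff0 /P raddf_sum (bigD1_seq v) //= mcoeffZ mcoeffX eqxx mulr1.
rewrite big1_seq ?addr0 => [/eqP|w /andP[wv wD]].
  by rewrite intr_eq0 monalg.mcoeff_eq0 vD.
rewrite mcoeffZ mcoeffX; case: eqP => [/mm_inj wv'|]; last by rewrite mulr0.
by rewrite wv' ?eqxx in wv.
Qed.

Lemma laurent_embedding_inj : injective laurent_embedding.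
Proof.
by move=> r s rs; apply/subr0_eq/laurent_embedding_eq0;
  rewrite rmorphB /= rs subrr.
Qed.

Definition frozen_inclusion (T : zmodType) (v : 'rV[T]_m) : 'rV[T]_(n + m) :=
  row_mx 0 v.

Fact frozen_inclusion_is_zmod_morphism (T : zmodType) :
  zmod_morphism (@frozen_inclusion T).
Proof. by move=> v w; rewrite /frozen_inclusion opp_row_mx add_row_mx subrr. Qed.

HB.instance Definition _ (T : zmodType) := GRing.isZmodMorphism.Build _ _
  (@frozen_inclusion T) (@frozen_inclusion_is_zmod_morphism T).

Lemma laurent_monomial_frozen v :
  laurent_monomial (frozen_inclusion v) = frozen_monomial n v.
Proof.
rewrite /laurent_monomial big_split_ord /= big1 ?mul1r => [|i _].
  by apply: eq_bigr => i _; rewrite row_mxEr.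
by rewrite row_mxEl mxE expr0z.
Qed.

Lemma laurent_embedding_frozen r :
  laurent_embedding (gr_map (@frozen_inclusion int) r) = coef_embedding n r.
Proof.
apply: (gr_additive_ext (f := laurent_embedding \o gr_map (@frozen_inclusion int))
  (f' := @coef_embedding n m)) => v /=.
by rewrite gr_map_exp laurent_embedding_exp laurent_monomial_frozen
  coef_embedding_exp.
Qed.

End LaurentEmbedding.

Section ClusterExpansion.
Variables (n m : nat) (Q : ice_quiver n m).
Hypothesis laurent_phenomenon :
  forall x, in_cluster_algebra Q x -> exists r, laurent_embedding r = x.

Local Notation A := (cluster_algebra Q).
Local Notation C := (group_algebra (@frozen_inclusion n m rat)).

Let laurent_of_ex (a : A) : exists r, laurent_embedding r = ca_val a.
Proof. by apply: laurent_phenomenon; apply/asboolP; exact: ca_valP a. Qed.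

Definition laurent_of (a : A) : ZP (n + m) := sval (cid (laurent_of_ex a)).

Lemma laurent_ofK a : laurent_embedding (laurent_of a) = ca_val a.
Proof. exact: (svalP (cid (laurent_of_ex a))). Qed.

Lemma laurent_of_eq a r : laurent_embedding r = ca_val a -> laurent_of a = r.
Proof. by move=> ra; apply: laurent_embedding_inj; rewrite laurent_ofK. Qed.

(** The Laurent expansion in the initial cluster, with exponents considered as
    rational ones so that the values lie in an algebra over the completed
    coefficients. *)
Definition rational_laurent (a : A) : C := completion (laurent_of a).

Fact rational_laurent_is_zmod_morphism : zmod_morphism rational_laurent.
Proof.
move=> a b; rewrite /rational_laurent -rmorphB; congr (completion _).
by apply: laurent_of_eq; rewrite rmorphB /= !laurent_ofK.
Qed.

Fact rational_laurent_is_monoid_morphism : monoid_morphism rational_laurent.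
Proof.
split=> [|a b]; rewrite /rational_laurent.
  by rewrite -[RHS](rmorph1 (@completion _)); congr (completion _);
    apply: laurent_of_eq; rewrite rmorph1.
rewrite -[RHS](rmorphM (@completion _)); congr (completion _).
by apply: laurent_of_eq; rewrite rmorphM /= !laurent_ofK.
Qed.

Lemma completion_exp k (v : 'rV[int]_k) :
  completion (gr_exp v) = gr_exp (map_mx intr v : 'rV[rat]_k).
Proof. by rewrite /completion /gr_lift monalg.mmapU mul1r. Qed.

Lemma completion_frozen r :
  completion (gr_map (@frozen_inclusion n m int) r) =
  gr_map (@frozen_inclusion n m rat) (completion r).
Proof.
apply: (gr_additive_ext (f := @completion _ \o gr_map (@frozen_inclusion n m int))
  (f' := gr_map (@frozen_inclusion n m rat) \o @completion _)) => v /=.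
rewrite gr_map_exp !completion_exp gr_map_exp.
by rewrite /frozen_inclusion map_row_mx map_mx0.
Qed.

Fact rational_laurent_is_scalable :
  scalable_for (@completion m \; *:%R) rational_laurent.
Proof.
move=> r a; rewrite /= group_algebra_scaleE -completion_frozen /rational_laurent.
rewrite -[RHS](rmorphM (@completion _)); congr (completion _).
apply: laurent_of_eq.
by rewrite rmorphM /= laurent_ofK laurent_embedding_frozen.
Qed.

HB.instance Definition _ := GRing.isZmodMorphism.Build A C rational_laurent
  rational_laurent_is_zmod_morphism.
HB.instance Definition _ := GRing.isMonoidMorphism.Build A C rational_laurent
  rational_laurent_is_monoid_morphism.
HB.instance Definition _ := GRing.isScalable.Build (ZP m) A C
  (@completion m \; *:%R) rational_laurent rational_laurent_is_scalable.

End ClusterExpansion.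

Section LaurentElements.
Variables n m : nat.
Local Notation is_laurent x := (exists r, @laurent_embedding n m r = x).

Lemma is_laurentD x y : is_laurent x -> is_laurent y -> is_laurent (x + y).
Proof. by move=> [r <-] [s <-]; exists (r + s); rewrite rmorphD. Qed.

Lemma is_laurentN x : is_laurent x -> is_laurent (- x).
Proof. by move=> [r <-]; exists (- r); rewrite rmorphN. Qed.

Lemma is_laurentM x y : is_laurent x -> is_laurent y -> is_laurent (x * y).
Proof. by move=> [r <-] [s <-]; exists (r * s); rewrite rmorphM. Qed.

Lemma is_laurent_coef r : is_laurent (coef_embedding n r).
Proof. by exists (gr_map (@frozen_inclusion n m int) r);
  rewrite laurent_embedding_frozen. Qed.

Lemma is_laurent_frozen v : is_laurent (frozen_monomial n v).
Proof. by rewrite -coef_embedding_exp; exact: is_laurent_coef. Qed.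

Lemma laurent_monomial_delta i (k : int) :
  laurent_monomial (\row_j (if j == i then k else 0)) = initial_var i ^ k :>
    ambient_field n m.
Proof.
rewrite /laurent_monomial (bigD1 i) //= mxE eqxx big1 ?mulr1 // => j ji.
by rewrite mxE (negbTE ji) expr0z.
Qed.

Lemma is_laurent_var i (k : int) : is_laurent (initial_var i ^ k :
  ambient_field n m).
Proof. by eexists; rewrite -laurent_monomial_delta -laurent_embedding_exp. Qed.

End LaurentElements.

(** The Laurent phenomenon is immediate for a solution of a linear recurrence in
    both directions whose coefficients are Laurent polynomials. *)
Lemma is_laurent_linear_var k : exists r, laurent_embedding r = linear_var k.
Proof.
have xL i : exists r, @laurent_embedding 2 2 r = initial_var i.
  by rewrite -[initial_var i]expr1z; exact: is_laurent_var.
have xVL i : exists r, @laurent_embedding 2 2 r = (initial_var i)^-1.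
  by rewrite -[_^-1]/(_ ^ (-1)); exact: is_laurent_var.
have x1L : exists r, laurent_embedding r = kronecker_x1 := xL _.
have x2L : exists r, laurent_embedding r = kronecker_x2 := xL _.
have y1L : exists r, laurent_embedding r = kronecker_y1 := xL _.
have y2L : exists r, laurent_embedding r = kronecker_y2 := xL _.
have qL : exists r, laurent_embedding r = kronecker_y1 * kronecker_y2.
  exact: (is_laurentM y1L y2L).
have qVL : exists r, laurent_embedding r = (kronecker_y1 * kronecker_y2)^-1.
  by rewrite invfM; apply: is_laurentM; exact: xVL.
have uL : exists r, laurent_embedding r = kronecker_u.
  rewrite /kronecker_u invfM; apply: is_laurentM.
    exact: (is_laurentD (is_laurentD (is_laurentM x1L x1L)
      (is_laurentM qL (is_laurentM x2L x2L))) y2L).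
  by apply: is_laurentM; exact: xVL.
move: k; apply: (@int_ind2 _ 0) => [||k h1 h0|k h1 h0].
- exact: xL.
- exact: (is_laurentM qL x2L).
- rewrite (linear_rec_next linear_varP).
  exact: (is_laurentD (is_laurentM uL h0) (is_laurentN (is_laurentM qL h1))).
have -> : linear_var (k - 1) = (kronecker_y1 * kronecker_y2)^-1 *
    (kronecker_u * linear_var k - linear_var (k + 1)).
  by rewrite -linear_varP [_ + _ * _]addrC addrK mulKf // kronecker_y_neq0.
exact: (is_laurentM qVL (is_laurentD (is_laurentM uL h0) (is_laurentN h1))).
Qed.

Lemma cluster_var_line w i : exists k, cluster_var kronecker w i = line_var k.
Proof.
have [p [l [h wp]]] := position_of_word w; rewrite /cluster_var.
case: (ord2_pairP i (pos_neq wp)) => ->.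
  by exists p; rewrite (pos_varl wp).
by exists (p + 1); rewrite (pos_varh wp).
Qed.

Lemma line_var_cluster k : exists w i, cluster_var kronecker w i = line_var k.
Proof.
have [w [l [h wp]]] := word_of_position k.
by exists w, l; rewrite /cluster_var (pos_varl wp).
Qed.

Lemma kronecker_laurent x :
  in_cluster_algebra kronecker x -> exists r, laurent_embedding r = x.
Proof.
elim=> [r|w i|{}x y _ IHx _ IHy|{}x y _ IHx _ IHy].
- exact: is_laurent_coef.
- have [k ->] := cluster_var_line w i; apply: is_laurentM.
    exact: is_laurent_frozen.
  exact: is_laurent_linear_var.
- exact: (is_laurentD IHx IHy).
- exact: (is_laurentM IHx IHy).
Qed.

(** Only these properties of the Laurent ring enter the rest of the proof, so its
    construction is hidden behind an existential statement. *)
Lemma kronecker_laurent_model :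
  exists (C : comAlgType (ZPhat 2))
    (f : {lrmorphism cluster_algebra kronecker -> C | @completion 2 \; *:%R})
    (mon : int -> int -> C) (slice : int -> int -> {scalar C}),
  [/\ mon 0 0 = 1,
      forall i j k l, mon i j * mon k l = mon (i + k) (j + l),
      forall i j k l, slice i j (mon k l) = ((k, l) == (i, j))%:R,
      forall a, ca_val a = kronecker_x1 -> f a = mon 1 0
    & forall a, ca_val a = kronecker_x2 -> f a = mon 0 1].
Proof.
pose pair_row (i j : int) : 'rV[int]_2 := \row_k (if k == 0 then i else j).
pose q_row (i j : int) : 'rV[rat]_2 := map_mx intr (pair_row i j).
have q_rowD i j k l : q_row i j + q_row k l = q_row (i + k) (j + l).
  by rewrite -map_mxD; congr map_mx; apply/rowP => c; rewrite !mxE; case: ifP.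
have q_row_eq i j k l : (q_row i j == q_row k l) = ((i, j) == (k, l)).
  apply/eqP/eqP => [/rowP e|[-> ->] //].
  by have := e 0; have := e 1; rewrite !mxE /= => /intr_inj -> /intr_inj ->.
pose prV : {additive 'rV[rat]_(2 + 2) -> 'rV[rat]_2} := @rsubmx rat 1 2 2.
pose prW : {additive 'rV[rat]_(2 + 2) -> 'rV[rat]_2} := @lsubmx rat 1 2 2.
have prVK : cancel (@frozen_inclusion 2 2 rat) prV by move=> v; exact: row_mxKr.
have prW0 v : prW (frozen_inclusion 2 v) = 0 by exact: row_mxKl.
pose C := group_algebra (@frozen_inclusion 2 2 rat).
pose mon (i j : int) : C := gr_exp (row_mx (q_row i j) 0 : 'rV[rat]_(2 + 2)).
have [slice sliceE] := gr_slice_exists prVK prW0.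
have image_var a (v : 'I_2) : ca_val a = initial_var (lshift 2 v) ->
    rational_laurent kronecker_laurent a = mon (v == 0)%:Z (v != 0)%:Z.
  move=> av; rewrite /rational_laurent.
  rewrite (@laurent_of_eq _ _ _ _ _ (gr_exp (\row_j (j == lshift 2 v)%:Z))).
    rewrite completion_exp; congr gr_exp; apply/rowP => c.
    rewrite !mxE; case: split_ordP => c' ->; rewrite ?eq_rlshift ?mxE //.
    rewrite eq_lshift; congr (_%:~R).
    by case: v c' {av} => -[|[|?]] // ? [[|[|?]] // ?].
  rewrite av laurent_embedding_exp -[RHS]expr1z -laurent_monomial_delta.
  by congr laurent_monomial; apply/rowP => c; rewrite !mxE; case: eqP.
exists C, (rational_laurent kronecker_laurent), mon, (fun i j =>
  slice (q_row i j)).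
split.
- rewrite /mon; have -> : q_row 0 0 = 0.
    by apply/rowP => c; rewrite !mxE; case: ifP.
  by rewrite row_mx0.
- by move=> i j k l; rewrite /mon -gr_expD add_row_mx addr0 q_rowD.
- move=> i j k l; rewrite sliceE /prW /prV /= row_mxKl row_mxKr q_row_eq.
  by case: ifP.
- exact: (fun a => image_var a ord0).
- exact: (fun a => image_var a ord_max).
Qed.

(** * Extensions of scalars, linear combinations, positivity *)

Section ScalarExtensionGeneration.
Variables (R S : comNzRingType) (phi : {rmorphism R -> S}).
Variables (A : comAlgType R) (Ahat : comAlgType S).
Variable j : {lrmorphism A -> Ahat | phi \; *:%R}.
Variable V : {pred Ahat}.
Hypothesis V_closed : subalg_closed V.
Hypothesis jV : forall a, j a \in V.

HB.instance Definition _ := GRing.isSubalgClosed.Build S Ahat V V_closed.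

Record generated := Generated { gen_val : Ahat; gen_valP : gen_val \in V }.

HB.instance Definition _ := [isSub for gen_val].
HB.instance Definition _ := [Choice of generated by <:].
HB.instance Definition _ := [SubChoice_isSubAlgebra of generated by <:].
Fact generated_mulC (x y : generated) : x * y = y * x.
Proof. by apply: val_inj; rewrite !rmorphM mulrC. Qed.

HB.instance Definition _ := GRing.PzRing_hasCommutativeMul.Build generated
  generated_mulC.

Definition generated_map (a : A) : generated := Generated (jV a).

Fact generated_map_is_zmod_morphism : zmod_morphism generated_map.
Proof. by move=> a b; apply: val_inj; rewrite rmorphB /= rmorphB. Qed.

Fact generated_map_is_monoid_morphism : monoid_morphism generated_map.
Proof.
split=> [|a b]; apply: val_inj; first by rewrite rmorph1 /= rmorph1.
by rewrite rmorphM /= rmorphM.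
Qed.

Fact generated_map_is_scalable : scalable_for (phi \; *:%R) generated_map.
Proof. by move=> r a; apply: val_inj; rewrite /= linearZ. Qed.

HB.instance Definition _ := GRing.isZmodMorphism.Build _ _ generated_map
  generated_map_is_zmod_morphism.
HB.instance Definition _ := GRing.isMonoidMorphism.Build _ _ generated_map
  generated_map_is_monoid_morphism.
HB.instance Definition _ := GRing.isScalable.Build R A generated
  (phi \; *:%R) generated_map generated_map_is_scalable.

Definition gen_comp (h : {lrmorphism Ahat -> generated}) (x : Ahat) : Ahat :=
  val (h x).

Fact gen_comp_is_zmod_morphism h : zmod_morphism (gen_comp h).
Proof. by move=> a b; rewrite /gen_comp !rmorphB. Qed.

Fact gen_comp_is_monoid_morphism h : monoid_morphism (gen_comp h).
Proof.
by split=> [|a b]; rewrite /gen_comp; [rewrite !rmorph1 | rewrite !rmorphM].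
Qed.

Fact gen_comp_is_scalable h : scalable (gen_comp h).
Proof.
move=> r a; have e : h (r *: a) = r *: h a by exact: linearZ.
by rewrite /gen_comp e (linearZ_LR (val : {linear generated -> Ahat})).
Qed.

HB.instance Definition _ h := GRing.isZmodMorphism.Build _ _ (gen_comp h)
  (gen_comp_is_zmod_morphism h).
HB.instance Definition _ h := GRing.isMonoidMorphism.Build _ _ (gen_comp h)
  (gen_comp_is_monoid_morphism h).
HB.instance Definition _ h := GRing.isScalable.Build S Ahat Ahat *:%R
  (gen_comp h) (gen_comp_is_scalable h).

(** The map from A to the subalgebra V extends to Ahat.  Followed by the inclusion
    of V it must be the identity, by the uniqueness of extensions. *)
Lemma scalar_extension_generated : is_scalar_extension j -> forall x, x \in V.
Proof.
move=> ext x.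
have [h hj _] := ext generated generated_map.
have [h0 _ h0_uniq] := ext Ahat j.
have -> : x = gen_val (h x); last exact: gen_valP.
pose vh : {lrmorphism Ahat -> Ahat} := gen_comp h.
pose id1 : {lrmorphism Ahat -> Ahat} := idfun.
transitivity (id1 x); first by [].
transitivity (vh x); last by [].
rewrite (h0_uniq id1) // (h0_uniq vh) // => a.
exact: (congr1 val (hj a)).
Qed.

End ScalarExtensionGeneration.

Section LinearCombinations.
Variables (R : nzRingType) (V : lmodType R) (N : set R) (B : set V).
Hypotheses (N0 : N 0) (N1 : N 1) (ND : forall r s, N r -> N s -> N (r + s))
  (NM : forall r s, N r -> N s -> N (r * s)).

(** The coefficients of repeated vectors can be added up. *)
Lemma lincombs_uniq v : lincombs N B v ->
  exists (s : seq V) (c : V -> R), [/\ uniq s, forall b, b \in s -> B b,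
    forall b, b \in s -> N (c b) & v = \sum_(b <- s) c b *: b].
Proof.
move=> [s [c [sB cN ->]]].
exists (undup s), (fun b => c b *+ count_mem b s); split.
- exact: undup_uniq.
- by move=> b; rewrite mem_undup; exact: sB.
- move=> b; rewrite mem_undup => /cN cb; elim: (count_mem b s) => // k IH.
  by rewrite mulrS; exact: ND.
rewrite -big_undup_iterop_count; apply: eq_bigr => b _.
by rewrite -scalerMnl Monoid.iteropE iter_addr addr0.
Qed.

Lemma lincombs_gen b : B b -> lincombs N B b.
Proof.
move=> Bb; exists [:: b], (fun=> 1); split=> [b'||];
  rewrite ?big_seq1 ?scale1r //.
by rewrite inE => /eqP ->.
Qed.

Lemma lincombsZ r v : N r -> lincombs N B v -> lincombs N B (r *: v).
Proof.
move=> Nr [s [c [sB cN ->]]]; exists s, (fun b => r * c b); split=> // [b bs|].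
  by apply: NM => //; exact: cN.
by rewrite scaler_sumr; apply: eq_bigr => b _; rewrite scalerA.
Qed.

Lemma lincombsD v w :
  lincombs N B v -> lincombs N B w -> lincombs N B (v + w).
Proof.
move=> /lincombs_uniq [s [c [us sB cN ->]]] /lincombs_uniq [t [d [ut tB dN ->]]].
pose restr (r : seq V) (e : V -> R) b := if b \in r then e b else 0.
have restrE (r : seq V) e : uniq r -> {subset r <= undup (s ++ t)} ->
    \sum_(b <- r) e b *: b = \sum_(b <- undup (s ++ t)) restr r e b *: b.
  move=> ur rst; rewrite [RHS](eq_bigr (fun b =>
    if b \in r then e b *: b else 0)).
    rewrite -big_mkcond -big_filter; apply: perm_big.
    apply: uniq_perm => //; first by rewrite filter_uniq // undup_uniq.
    move=> b; rewrite mem_filter; case: (boolP (b \in r)) => // /rst -> //.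
  by move=> b _; rewrite /restr; case: ifP => // _; rewrite scale0r.
exists (undup (s ++ t)), (fun b => restr s c b + restr t d b); split.
- by move=> b; rewrite mem_undup mem_cat => /orP [/sB|/tB].
- by move=> b _; apply: ND; rewrite /restr; case: ifP => // ?;
  [exact: cN | exact: dN].
rewrite (restrE s c) // => [|b bs]; last by rewrite mem_undup mem_cat bs.
rewrite (restrE t d) // => [|b bt]; last by rewrite mem_undup mem_cat bt orbT.
by rewrite -big_split; apply: eq_bigr => b _; rewrite scalerDl.
Qed.

End LinearCombinations.

Section PositiveLaurent.
Variables (G : zmodType) (E : comAlgType (group_ring G)) (n : nat).
Variable z : 'I_n -> E.
Local Notation ev := (mmap (in_alg E) z).

(** The condition that a single cluster z contributes to positive_element. *)
Definition positive_in (e : E) : Prop :=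
  exists (a : 'I_n -> nat) (p : mpoly n (group_ring G)),
    (forall u, gr_nonneg p@_u) /\ (\prod_(i < n) z i ^+ a i) * e = ev p.

Definition nonneg_poly (p : mpoly n (group_ring G)) := forall u, gr_nonneg p@_u.

Lemma nonneg_polyD p q : nonneg_poly p -> nonneg_poly q -> nonneg_poly (p + q).
Proof. by move=> p0 q0 u; rewrite mcoeffD; apply: gr_nonnegD. Qed.

Lemma nonneg_polyM p q : nonneg_poly p -> nonneg_poly q -> nonneg_poly (p * q).
Proof.
move=> p0 q0 u; rewrite (mcoeff_poly_mul _ _ (leqnn _)).
by apply: gr_nonneg_sum => ? _; apply: gr_nonnegM.
Qed.

Lemma nonneg_polyC s : gr_nonneg s -> nonneg_poly s%:MP.
Proof.
move=> s0 u; rewrite mcoeffC.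
by case: eqP => _; rewrite ?mulr1 ?mulr0 //; exact: gr_nonneg0.
Qed.

Lemma nonneg_polyX m : nonneg_poly 'X_[m].
Proof.
by move=> u; rewrite mcoeffX; case: eqP; [move=> _; exact: gr_nonneg1|move=> _;
  exact: gr_nonneg0].
Qed.

Let mon (a : 'I_n -> nat) : mpoly n (group_ring G) := 'X_[[multinom a i | i < n]].

Let ev_mon a : ev (mon a) = \prod_(i < n) z i ^+ a i.
Proof. by rewrite mmapX /mmap1; apply: eq_bigr => i _; rewrite mnmE. Qed.

Lemma positive_inD e f : positive_in e -> positive_in f -> positive_in (e + f).
Proof.
move=> [a [p [p0 pe]]] [b [q [q0 qf]]].
exists (fun i => a i + b i)%N, (mon b * p + mon a * q); split.
  by apply: nonneg_polyD; apply: nonneg_polyM => //; exact: nonneg_polyX.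
rewrite rmorphD !rmorphM /= !ev_mon -pe -qf.
rewrite (eq_bigr (fun i => z i ^+ a i * z i ^+ b i)) => [|i _];
  last by rewrite exprD.
by rewrite big_split /=; ring.
Qed.

Lemma positive_inM e f : positive_in e -> positive_in f -> positive_in (e * f).
Proof.
move=> [a [p [p0 pe]]] [b [q [q0 qf]]].
exists (fun i => a i + b i)%N, (p * q); split; first exact: nonneg_polyM.
rewrite rmorphM /= -pe -qf.
rewrite (eq_bigr (fun i => z i ^+ a i * z i ^+ b i)) => [|i _];
  last by rewrite exprD.
by rewrite big_split /=; ring.
Qed.

Lemma positive_in_scalar s : gr_nonneg s -> positive_in s%:A.
Proof.
move=> s0; exists (fun=> 0), s%:MP; split; first exact: nonneg_polyC.
by rewrite big1 ?mul1r // mmapC.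
Qed.

Lemma positive_inZ s e : gr_nonneg s -> positive_in e -> positive_in (s *: e).
Proof.
by move=> s0 e0; rewrite -mulr_algl; apply: positive_inM => //;
  exact: positive_in_scalar.
Qed.

Lemma positive_in0 : positive_in 0.
Proof. by have := positive_in_scalar (@gr_nonneg0 G); rewrite scale0r. Qed.

Lemma positive_in1 : positive_in 1.
Proof. by have := positive_in_scalar (@gr_nonneg1 G); rewrite scale1r. Qed.

Lemma positive_in_var i : positive_in (z i).
Proof.
exists (fun=> 0), 'X_i; split; first exact: nonneg_polyX.
by rewrite big1 ?mul1r // mmapX mmap1U.
Qed.

Lemma positive_inXn e k : positive_in e -> positive_in (e ^+ k).
Proof.
move=> e0; elim: k => [|k IH]; first exact: positive_in1.
by rewrite exprS; apply: positive_inM.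
Qed.

Lemma positive_in_sum (I : eqType) (r : seq I) (F : I -> E) :
  (forall i, i \in r -> positive_in (F i)) -> positive_in (\sum_(i <- r) F i).
Proof.
move=> F0; rewrite big_seq; elim/big_ind: _ => //; first exact: positive_in0.
exact: positive_inD.
Qed.

Lemma positive_in_div i e : positive_in (z i * e) -> positive_in e.
Proof.
move=> [a [p [p0 pe]]]; exists (fun k => a k + (k == i))%N, p; split=> //.
rewrite -pe (eq_bigr (fun k => z k ^+ a k * z k ^+ (k == i))) => [|k _].
  rewrite big_split /= (bigD1 i (F := fun k => z k ^+ (k == i))) //= eqxx expr1.
  by rewrite [X in _ * (_ * X)]big1 ?mulr1 ?mulrA // => k /negbTE ->.
by rewrite exprD.
Qed.

End PositiveLaurent.

Section PositiveSequence.
Variables (E : comNzRingType) (Pos : E -> Prop) (u : E) (z : int -> E).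
Hypotheses (zP : linear_rec 1 u z)
  (z01 : z 0 ^+ 2 + z 1 ^+ 2 + 1 = u * z 0 * z 1).
Hypotheses (Pos0 : Pos 0) (Pos1 : Pos 1)
  (PosD : forall e f, Pos e -> Pos f -> Pos (e + f))
  (PosM : forall e f, Pos e -> Pos f -> Pos (e * f))
  (Posz0 : Pos (z 0)) (Posz1 : Pos (z 1))
  (Pos_div0 : forall e, Pos (z 0 * e) -> Pos e)
  (Pos_div1 : forall e, Pos (z 1 * e) -> Pos e).

(** z_k and rec_cross k are computed without subtraction, up to division by z_0
    and z_1. *)
Lemma positive_forward (n : nat) : Pos (z n).
Proof.
suff [] : Pos (z n) /\ Pos (rec_cross z n) by [].
elim: n => [|n [IHz IHc]].
  by rewrite /rec_cross add0r mulrC subrr.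
have -> : n.+1%:Z = n%:Z + 1 by lia.
split.
  apply: Pos_div0; rewrite -(subrK (z 1 * z n) (z 0 * _)) -/(rec_cross z n).
  by apply: PosD => //; apply: PosM.
apply/Pos_div1/Pos_div0; rewrite mulrA (rec_crossS zP z01).
by apply: PosD; apply: PosM => //; apply: PosD => //; rewrite expr2; apply: PosM.
Qed.

End PositiveSequence.

(** * Rescaling by square roots of the frozen variables *)

Local Notation A := (cluster_algebra kronecker).

Lemma line_var_in k : line_var k \in cluster_pred kronecker.
Proof.
by have [w [i <-]] := line_var_cluster k; apply/asboolP; exact: InVar.
Qed.

Definition ca_line (k : int) : A := ClusterAlgebra (line_var_in k).

Lemma ca_val_inj : injective (@ca_val 2 2 kronecker).
Proof. exact: val_inj. Qed.

Lemma ca_valD (a b : A) : ca_val (a + b) = ca_val a + ca_val b.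
Proof. by []. Qed.

Lemma ca_valM (a b : A) : ca_val (a * b) = ca_val a * ca_val b.
Proof. by []. Qed.

Lemma ca_scale_exp (v : 'rV[int]_2) (a : A) :
  ca_val (gr_exp v *: a) = F v * ca_val a.
Proof. by rewrite /= coef_embedding_exp. Qed.

Lemma frozen_in v : F v \in cluster_pred kronecker.
Proof. by rewrite -coef_embedding_exp; exact: coef_in_cluster_algebra. Qed.

Lemma linear_varE k : linear_var k = F (line_exponent k) * line_var k.
Proof.
by rewrite /line_var mulrA -frozen_monomialD subrr frozen_monomial0 mul1r.
Qed.

Lemma linear_var_in k : linear_var k \in cluster_pred kronecker.
Proof. by rewrite linear_varE rpredM ?frozen_in ?line_var_in. Qed.

Definition ca_linear (k : int) : A := ClusterAlgebra (linear_var_in k).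

Lemma kronecker_uE : kronecker_u = F (- delta_exponent 0) *
  (linear_var (- 1) * linear_var 2 - linear_var 0 * linear_var 1).
Proof.
have := rec_distance3 linear_varP 0; rewrite sub0r !add0r => ->.
rewrite addrC addKr rec_defect_linear_var mulrC -mulrA.
by rewrite [F _ * F _]mulrC frozen_monomialNK mulr1.
Qed.

Lemma kronecker_u_in : kronecker_u \in cluster_pred kronecker.
Proof.
by rewrite kronecker_uE rpredM ?frozen_in // rpredB // rpredM ?linear_var_in.
Qed.

Definition ca_u : A := ClusterAlgebra kronecker_u_in.

Lemma ca_linearE k : ca_linear k = gr_exp (line_exponent k) *: ca_line k.
Proof. by apply: ca_val_inj; rewrite ca_scale_exp; exact: linear_varE. Qed.

Lemma ca_linear_rec k :
  ca_linear (k + 1) + gr_exp (const_mx 1) *: ca_linear (k - 1) = ca_u *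
    ca_linear k.
Proof.
apply: ca_val_inj; rewrite ca_valD ca_scale_exp ca_valM frozen_const1.
exact: linear_varP.
Qed.

Lemma ca_linear_defect : ca_u * ca_linear 0 * ca_linear 1 =
  ca_linear 1 ^+ 2 + gr_exp (const_mx 1) *: ca_linear 0 ^+ 2 + gr_exp
    (delta_exponent 1) *: 1.
Proof.
apply: ca_val_inj; rewrite !ca_valD !ca_scale_exp !ca_valM mulr1.
rewrite -rec_defect_linear_var /rec_defect subrr frozen_const1 /=.
move: (linear_var 0) (linear_var 1) kronecker_u (_ * kronecker_y2) => a b c d.
by ring.
Qed.

(** y^(half_vec v) is the square root of y^v. *)
Definition half_vec (v : 'rV[int]_2) : 'rV[rat]_2 := 2^-1 *: map_mx intr v.

Fact half_vec_is_zmod_morphism : zmod_morphism half_vec.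
Proof. by move=> v w; rewrite /half_vec map_mxB scalerBr. Qed.

HB.instance Definition _ := GRing.isZmodMorphism.Build _ _ half_vec
  half_vec_is_zmod_morphism.

Lemma half_vecMn2 v : half_vec (v *+ 2) = map_mx intr v.
Proof.
have half2 : 2^-1 + 2^-1 = 1 :> rat by [].
by rewrite /half_vec mulr2n map_mxD scalerDr -scalerDl half2 scale1r.
Qed.

(** (m, a, b) stands for x_m^a x_(m+1)^b, and n for F_(n+1)(u). *)
Definition basis_index := ((int * nat * nat) + nat)%type.

Definition basis_form (R : nzRingType) (u : R) (z : int -> R)
    (i : basis_index) : R :=
  match i with
  | inl (m, a, b) => z m ^+ a * z (m + 1) ^+ b
  | inr n => chebyshev 1 u n.+1
  end.

(** A power of a single variable belongs to two clusters, and 1 to all of them.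
    Normal indices name the cluster by its leftmost variable that occurs; they
    are in bijection with the basis, see basis_ca_inj. *)
Definition normal_index (i : basis_index) : bool :=
  match i with
  | inl (m, a, b) => (0 < a)%N || [&& m == 0, a == 0%N & b == 0%N]
  | inr _ => true
  end.

Definition ca_q : A := gr_exp (const_mx 1) *: 1.

Lemma ca_val_q : ca_val ca_q = kronecker_y1 * kronecker_y2.
Proof. by rewrite ca_scale_exp frozen_const1 mulr1. Qed.

Definition basis_ca (i : basis_index) : A :=
  match i with
  | inl (m, a, b) => ca_line m ^+ a * ca_line (m + 1) ^+ b
  | inr n => chebyshev ca_q ca_u n.+1
  end.

Definition basis_exponent (i : basis_index) : 'rV[int]_2 :=
  match i with
  | inl (m, a, b) => - (g_exponent m *+ a + g_exponent (m + 1) *+ b)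
  | inr n => const_mx 1 *+ n.+1
  end.

Lemma ca_val_line m a b :
  ca_val (ca_line m ^+ a * ca_line (m + 1) ^+ b) = line_var m ^+ a * line_var
    (m + 1) ^+ b.
Proof.
by rewrite -[ca_val _]/(val _) rmorphM !rmorphXn.
Qed.

Lemma ca_val_chebyshev n : ca_val (chebyshev ca_q ca_u n) =
  chebyshev (kronecker_y1 * kronecker_y2) kronecker_u n.
Proof.
rewrite -[ca_val _]/(val _) rmorph_chebyshev; congr (chebyshev _ _ _).
exact: ca_val_q.
Qed.

Lemma cluster_monomialP x : cluster_monomials kronecker x <->
  exists m a b, x = line_var m ^+ a * line_var (m + 1) ^+ b.
Proof.
split=> [[w [e ->]]|[m [a [b ->]]]].
  have [p [l [h wp]]] := position_of_word w.
  exists p, (e l), (e h); rewrite (big_ord2_pair _ _ (pos_neq wp)) /cluster_var.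
  by rewrite (pos_varl wp) (pos_varh wp).
have [w [l [h wp]]] := word_of_position m.
exists w, (fun i => if i == l then a else b).
rewrite (big_ord2_pair _ _ (pos_neq wp)) /cluster_var.
by rewrite (pos_varl wp) (pos_varh wp) eqxx eq_sym (negbTE (pos_neq wp)).
Qed.

Lemma normal_monomial (R : nzRingType) (z : int -> R) m a b : exists m' a' b',
  normal_index (inl (m', a', b')) /\
  z m ^+ a * z (m + 1) ^+ b = z m' ^+ a' * z (m' + 1) ^+ b'.
Proof.
case: a => [|a]; last by exists m, a.+1, b.
case: b => [|b]; first by exists 0, 0%N, 0%N; rewrite !expr0.
by exists (m + 1), b.+1, 0%N; rewrite !expr0 mul1r mulr1.
Qed.

Lemma kronecker_basisP (a : A) :
  kronecker_basis (ca_val a) <-> exists2 i, normal_index i & a = basis_ca i.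
Proof.
split=> [[/cluster_monomialP [m [e [f ax]]]|[n /= n0 ax]]|[[[[m e] f]|n] _ ->]].
- have [m' [e' [f' [nn eq']]]] := normal_monomial line_var m e f.
  exists (inl (m', e', f')) => //; apply: ca_val_inj.
  by rewrite ca_val_line -eq'.
- case: n n0 ax => // n _ ax; exists (inr n) => //; apply: ca_val_inj.
  by rewrite ca_val_chebyshev.
- by left; apply/cluster_monomialP; exists m, e, f; rewrite ca_val_line.
- by right; exists n.+1 => //; rewrite ca_val_chebyshev.
Qed.

Section Rescaling.
Variables (S : comNzRingType) (E : comAlgType S) (j : {rmorphism A -> E}).
Variable yroot : 'rV[int]_2 -> S.
Hypotheses (yroot0 : yroot 0 = 1)
  (yrootD : forall v w, yroot (v + w) = yroot v * yroot w)
  (j_scale : forall v (a : A), j (gr_exp v *: a) = yroot (v *+ 2) *: j a).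

Lemma yrootNK v : yroot (- v) * yroot v = 1.
Proof. by rewrite -yrootD addNr yroot0. Qed.

Lemma yrootXn v n : yroot v ^+ n = yroot (v *+ n).
Proof.
elim: n => [|n IH]; first by rewrite expr0 mulr0n yroot0.
by rewrite exprS IH -yrootD mulrS.
Qed.

Definition rescaled_var (k : int) : E := yroot (g_exponent k) *: j (ca_line k).

Definition rescaled_u : E := yroot (- const_mx 1) *: j ca_u.

Lemma rescaled_varE k : rescaled_var k = yroot (- delta_exponent k) *: j
  (ca_linear k).
Proof. by rewrite /rescaled_var ca_linearE j_scale scalerA -yrootD addrC. Qed.

Lemma rescaled_var_rec : linear_rec 1 rescaled_u rescaled_var.
Proof.
move=> k; rewrite mul1r !rescaled_varE /rescaled_u -scalerAl -scalerAr scalerA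
  -yrootD.
have -> : - const_mx 1 - delta_exponent k = - delta_exponent (k + 1).
  by rewrite delta_exponentS opprD.
rewrite -rmorphM -ca_linear_rec rmorphD /= j_scale scalerDr scalerA -yrootD.
by congr (_ + yroot _ *: _); apply/rowP => i; rewrite !mxE; lia.
Qed.

Lemma rescaled_var_01 : rescaled_var 0 ^+ 2 + rescaled_var 1 ^+ 2 + 1 =
  rescaled_u * rescaled_var 0 * rescaled_var 1.
Proof.
have jdef : j ca_u * j (ca_linear 0) * j (ca_linear 1) =
    j (ca_linear 1) ^+ 2 + yroot (const_mx 1 *+ 2) *: j (ca_linear 0) ^+ 2 +
    yroot (delta_exponent 1 *+ 2) *: 1.
  rewrite -!rmorphM ca_linear_defect; do 2!rewrite rmorphD /=.
  by rewrite rmorphXn !j_scale rmorph1 rmorphXn.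
rewrite !rescaled_varE /rescaled_u -!scalerAl -!scalerAr -!scalerAl !scalerA
  -!yrootD jdef.
rewrite !exprZn !yrootXn !scalerDr !scalerA -!yrootD.
rewrite -[X in _ + _ + X = _](scale1r 1) -yroot0.
rewrite [_ *: j (ca_linear 0) ^+ 2 + _]addrC.
by congr (yroot _ *: _ + yroot _ *: _ + yroot _ *: _); apply/rowP => i;
  rewrite !mxE; lia.
Qed.

Lemma j_lineXn k a : j (ca_line k) ^+ a = yroot (- g_exponent k *+ a) *:
  rescaled_var k ^+ a.
Proof.
rewrite /rescaled_var exprZn scalerA yrootXn -yrootD mulNrn addNr yroot0 scale1r.
by [].
Qed.

(** Up to invertible scalars the basis elements are the same expressions without
    coefficients. *)
Lemma j_basis_ca i : j (basis_ca i) = yroot (basis_exponent i) *: basis_form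
  rescaled_u rescaled_var i.
Proof.
case: i => [[[m a] b]|n]; rewrite /basis_ca /basis_form /basis_exponent.
  rewrite rmorphM !rmorphXn /= !j_lineXn -scalerAl -scalerAr scalerA -yrootD.
  by rewrite !mulNrn opprD.
rewrite rmorph_chebyshev /ca_q j_scale rmorph1.
have -> : yroot (const_mx 1 *+ 2) *: (1 : E) = (yroot (const_mx 1))%:A ^+ 2 * 1.
  by rewrite mulr1 exprZn expr1n yrootXn.
have -> : j ca_u = (yroot (const_mx 1))%:A * rescaled_u.
  by rewrite mulr_algl /rescaled_u scalerA -yrootD subrr yroot0 scale1r.
by rewrite chebyshev_scale exprZn expr1n mulr_algl yrootXn.
Qed.

End Rescaling.

(** * Expansions of the basis elements *)

Section ClusterExpansions.
Variables (S : comNzRingType) (E C : comAlgType S) (mon : int -> int -> C).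
Variable slice : int -> int -> {scalar C}.
Hypotheses (mon0 : mon 0 0 = 1)
  (monD : forall i j k l, mon i j * mon k l = mon (i + k) (j + l))
  (slice_mon : forall i j k l, slice i j (mon k l) = ((k, l) == (i, j))%:R).
Variables (u : E) (z : int -> E).
Hypotheses (zP : linear_rec 1 u z)
  (z01 : z 0 ^+ 2 + z 1 ^+ 2 + 1 = u * z 0 * z 1)
  (indep01 : alg_indep2 (z 0) (z 1)).

(** Exchange relations carry the independence of the initial cluster along the
    exchange graph. *)
Lemma alg_indep2_cluster p : alg_indep2 (z p) (z (p + 1)).
Proof.
move: p; apply: (@int_ind2 _ 0) => [||k _ IH|k _ IH] //.
- apply: alg_indep2_exchange (alg_indep2_sym indep01).
  by have := markov_exchange zP z01 1; rewrite subrr.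
- apply: alg_indep2_exchange (alg_indep2_sym IH).
  by have := markov_exchange zP z01 (k + 1); rewrite addrK.
- apply/alg_indep2_sym; rewrite subrK; apply: alg_indep2_exchange IH.
  by rewrite mulrC (markov_exchange zP z01).
Qed.

Definition expands_at (p : int) : E -> C -> Prop :=
  expands (eval2 (z p) (z (p + 1))) (eval2 (mon 1 0) (mon 0 1)) 'X%:P 'X.

Let monXV : mon (- 1) 0 * eval2 (mon 1 0) (mon 0 1) 'X%:P = 1.
Proof. by rewrite eval2X monD addNr addr0. Qed.

Let monYV : mon 0 (- 1) * eval2 (mon 1 0) (mon 0 1) 'X = 1.
Proof. by rewrite eval2Y monD addNr addr0. Qed.

Lemma expands_at_unique p e l1 l2 :
  expands_at p e l1 -> expands_at p e l2 -> l1 = l2.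
Proof. exact: (expands_unique (@alg_indep2_cluster p) monXV monYV). Qed.

Lemma expands_at_scalar p s : expands_at p s%:A s%:A.
Proof.
have := @expands_scalar S E C _ (eval2 (z p) (z (p + 1)))
  (eval2 (mon 1 0) (mon 0 1)) (fun s => s%:P%:P) 'X%:P 'X.
by apply=> t; exact: eval2C.
Qed.

Lemma expands_at_low p : expands_at p (z p) (mon 1 0).
Proof.
have := @expandsX _ E C _ (eval2 (z p) (z (p + 1))) (eval2 (mon 1 0) (mon 0 1))
  'X%:P 'X.
by rewrite /= !eval2X.
Qed.

Lemma expands_at_high p : expands_at p (z (p + 1)) (mon 0 1).
Proof.
have := @expandsY _ E C _ (eval2 (z p) (z (p + 1))) (eval2 (mon 1 0) (mon 0 1))
  'X%:P 'X.
by rewrite /= !eval2Y.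
Qed.

Lemma expands_atD p e1 e2 l1 l2 :
  expands_at p e1 l1 -> expands_at p e2 l2 -> expands_at p (e1 + e2) (l1 + l2).
Proof. exact: expandsD. Qed.

Lemma expands_atM p e1 e2 l1 l2 :
  expands_at p e1 l1 -> expands_at p e2 l2 -> expands_at p (e1 * e2) (l1 * l2).
Proof. exact: expandsM. Qed.

Lemma expands_atZ p s e l : expands_at p e l -> expands_at p (s *: e) (s *: l).
Proof.
rewrite -(mulr_algl s e) -(mulr_algl s l); apply: expands_atM.
exact: expands_at_scalar.
Qed.

Lemma expands_at0 p : expands_at p 0 0.
Proof. by have := expands_at_scalar p 0; rewrite !scale0r. Qed.

Lemma expands_at1 p : expands_at p 1 1.
Proof. by have := expands_at_scalar p 1; rewrite !scale1r. Qed.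

Lemma expands_atB p e1 e2 l1 l2 :
  expands_at p e1 l1 -> expands_at p e2 l2 -> expands_at p (e1 - e2) (l1 - l2).
Proof.
by move=> h1 h2; rewrite -(scaleN1r e2) -(scaleN1r l2);
  apply/expands_atD/expands_atZ.
Qed.

Lemma expands_atXn p e l n : expands_at p e l -> expands_at p (e ^+ n) (l ^+ n).
Proof.
move=> h; elim: n => [|n IH]; first exact: expands_at1.
by rewrite !exprS; apply: expands_atM.
Qed.

Lemma expands_at_sum p (T : Type) (r : seq T) (f : T -> E) (g : T -> C) :
  (forall i, expands_at p (f i) (g i)) ->
  expands_at p (\sum_(i <- r) f i) (\sum_(i <- r) g i).
Proof.
move=> h; elim/big_ind2: _ => //; first exact: expands_at0.
by move=> *; apply: expands_atD.
Qed.

Lemma expands_at_prod p (T : Type) (r : seq T) (f : T -> E) (g : T -> C) :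
  (forall i, expands_at p (f i) (g i)) ->
  expands_at p (\prod_(i <- r) f i) (\prod_(i <- r) g i).
Proof.
move=> h; elim/big_ind2: _ => //; first exact: expands_at1.
by move=> *; apply: expands_atM.
Qed.

Lemma expands_at_div_low p e l : expands_at p (z p * e) l ->
  expands_at p e (mon (- 1) 0 * l).
Proof.
have := @expands_divX _ E C _ (eval2 (z p) (z (p + 1)))
  (eval2 (mon 1 0) (mon 0 1)) 'X%:P 'X _ monXV e l.
by rewrite /= eval2X.
Qed.

Lemma expands_at_div_high p e l :
  expands_at p (z (p + 1) * e) l -> expands_at p e (mon 0 (- 1) * l).
Proof.
have := @expands_divY _ E C _ (eval2 (z p) (z (p + 1)))
  (eval2 (mon 1 0) (mon 0 1)) 'X%:P 'X _ monYV e l.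
by rewrite /= eval2Y.
Qed.

Definition laurent_u : C := mon 1 (- 1) + mon (- 1) 1 + mon (- 1) (- 1).

Definition laurent_var : int -> C := linear_seq 1 laurent_u 1 (mon 1 0) (mon 0 1).

Lemma laurent_varP : linear_rec 1 laurent_u laurent_var.
Proof. by apply: linear_seqP; rewrite mulr1. Qed.

Lemma expands_at_u p : expands_at p u laurent_u.
Proof.
have -> : laurent_u = mon (- 1) 0 * (mon 0 (- 1) * (mon 1 0 ^+ 2 + mon 0 1 ^+ 2
  + 1)).
  by rewrite -mon0 !(monXn mon0 monD) !mulrDr !monD.
apply/expands_at_div_low/expands_at_div_high.
have -> : z (p + 1) * (z p * u) = z p ^+ 2 + z (p + 1) ^+ 2 + 1.
  by rewrite (markov_triple zP z01); ring.
apply: expands_atD; last exact: expands_at1.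
apply: expands_atD; apply: expands_atXn; first exact: expands_at_low.
exact: expands_at_high.
Qed.

Lemma expands_at_var p k : expands_at p (z k) (laurent_var (k - p)).
Proof.
have -> : k = p + (k - p) by rewrite addrC subrK.
rewrite [p + _]addrC addrK addrC; move: (k - p) => {}k; move: k.
apply: (@int_ind2 _ 0) => [||k h1 h0|k h1 h0].
- by rewrite addr0; exact: expands_at_low.
- by rewrite add0r; exact: expands_at_high.
- rewrite addrA (linear_rec_next zP) (linear_rec_next laurent_varP) !mul1r.
  apply: expands_atB; first exact: expands_atM (expands_at_u p) h0.
  by rewrite -addrA.
have prev (R : comNzRingType) (v : R) y k' : linear_rec 1 v y ->
  y (k' - 1) = v * y k' - y (k' + 1).
  by move=> /(_ k') <-; rewrite mul1r [y (k' + 1) + _]addrC addrK.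
rewrite addrA (prev _ _ _ _ zP) (prev _ _ _ _ laurent_varP).
apply: expands_atB; first exact: expands_atM (expands_at_u p) h0.
by rewrite -addrA.
Qed.

Lemma expands_at_chebyshev p n :
  expands_at p (chebyshev 1 u n) (chebyshev 1 laurent_u n).
Proof.
elim/chebyshev_ind: n => [|||n IH1 IH2]; rewrite ?chebyshevSS.
- exact: expands_at1.
- exact: expands_at_u.
- rewrite /= !mulr1; apply: expands_atB; first exact/expands_atXn/expands_at_u.
  by apply: expands_atD; exact: expands_at1.
- apply: expands_atB; last by rewrite !mul1r.
  exact: expands_atM (expands_at_u p) IH2.
Qed.

(** The expansion in the cluster p of the basis element with index i: all clusters
    look alike, only the indices are shifted. *)
Definition laurent_form (p : int) : basis_index -> C :=
  basis_form laurent_u (fun k => laurent_var (k - p)).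

Lemma expands_at_form p i : expands_at p (basis_form u z i) (laurent_form p i).
Proof.
case: i => [[[m a] b]|n]; last exact: expands_at_chebyshev.
by apply: expands_atM; apply/expands_atXn/expands_at_var.
Qed.

Let cluster_slice_var := cluster_slice mon0 monD slice_mon laurent_varP
  (erefl _) (erefl _) (erefl _).
Let chebyshev_slice_u := chebyshev_slice mon0 monD slice_mon laurent_varP
  (erefl _) (erefl _) (erefl _).

Let laurent_form_pure m a b p : laurent_form p (inl (m, a, b)) =
  laurent_var (m - p) ^+ a * laurent_var (m - p + 1) ^+ b.
Proof. by rewrite /laurent_form /= addrAC. Qed.

Lemma laurent_form_slice_monomial m a b i :
  normal_index (inl (m, a, b)) -> normal_index i ->
  slice a%:Z b%:Z (laurent_form m i) = (i == inl (m, a, b))%:R.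
Proof.
move=> n0; case: i => [[[m' a'] b']|n] ni; last first.
  by rewrite chebyshev_slice_u; [case: eqP => // -[]; lia | left].
rewrite laurent_form_pure; case: (posnP a') => [a'0|a'_gt0].
  move: ni; rewrite /= a'0 /= => /andP [/eqP -> /eqP ->].
  rewrite !expr0 mulr1 -mon0 slice_mon; congr (nat_of_bool _)%:R.
  move: n0 => /= /orP [a_gt0|/and3P [/eqP -> /eqP -> /eqP ->]] //.
  by apply/eqP/eqP => -[]; lia.
rewrite cluster_slice_var //; last by left.
  congr (nat_of_bool _)%:R; rewrite subr_eq0.
  apply/andP/eqP => [[/eqP -> /eqP [-> ->]]|[-> -> ->]] //.
by move: n0 => /= /orP [|/and3P [_ _ /eqP ->]] //; lia.
Qed.

Lemma laurent_form_slice_chebyshev p n i :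
  normal_index i -> (forall m a b, i = inl (m, a, b) -> p <= m) ->
  slice n.+1%:Z (- n.+1%:Z) (laurent_form p i) = (i == inr n)%:R.
Proof.
case: i => [[[m' a'] b']|n'] ni pm; last first.
  rewrite chebyshev_slice_u; last by right.
  by congr (nat_of_bool _)%:R; apply/eqP/eqP => -[]; [move=> ? _; congr inr;
    lia | move=> ->].
rewrite laurent_form_pure; case: (posnP a') => [a'0|a'_gt0].
  move: ni; rewrite /= a'0 /= => /andP [/eqP -> /eqP ->].
  by rewrite !expr0 mulr1 -mon0 slice_mon.
rewrite cluster_slice_var //.
  by case: eqP => //= _; case: eqP => // -[]; lia.
by right; split => //; rewrite subr_ge0; apply: pm.
Qed.

Lemma lower_bound_index (I : seq basis_index) :
  exists p, forall i m a b, i \in I -> i = inl (m, a, b) -> p <= m.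
Proof.
elim: I => [|[[[m a] b]|n] I [p IH]]; first by exists 0.
  exists (Num.min m p) => i m' a' b'; rewrite inE => /orP [/eqP ->
    [-> _ _]|iI im'].
    by rewrite ge_min lexx.
  by rewrite ge_min (IH _ _ _ _ iI im') orbT.
by exists p => i m' a' b'; rewrite inE => /orP [/eqP -> //|]; exact: IH.
Qed.

(** A cluster monomial is recognised in its own cluster by its own exponent, and
    F_n by the exponent (n, -n) in a cluster p to the left of all monomials
    involved. *)
Lemma separating_slice (I : seq basis_index) i0 :
  all normal_index I -> normal_index i0 -> exists p k l,
  forall i, i \in I -> slice k l (laurent_form p i) = (i == i0)%:R.
Proof.
move=> /allP nI; case: i0 => [[[m a] b]|n] n0.
  by exists m, a, b => i /nI ni; exact: laurent_form_slice_monomial.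
have [p pP] := lower_bound_index I.
exists p, n.+1, (- n.+1%:Z) => i iI.
by apply: laurent_form_slice_chebyshev; [exact: nI | move=> *; apply: pP iI _;
  eassumption].
Qed.

Lemma coefficient_slice (T : eqType) (s : seq T)
    (idx : T -> basis_index) (c : T -> S) b0 :
    uniq s -> {in s &, injective idx} -> (forall b, b \in s ->
      normal_index (idx b)) ->
    b0 \in s ->
  exists p k l x, expands_at p (\sum_(b <- s) c b *: basis_form u z (idx b)) x /\
    slice k l x = c b0.
Proof.
move=> us idx_inj ns b0s.
have nI : all normal_index [seq idx b | b <- s].
  by apply/allP => _ /mapP [b bs ->]; exact: ns.
have [p [k [l sep]]] := separating_slice nI (ns _ b0s).
exists p, k, l, (\sum_(b <- s) c b *: laurent_form p (idx b)); split.
  by apply: expands_at_sum => b; exact/expands_atZ/expands_at_form.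
rewrite raddf_sum (bigD1_seq b0) //= scalarZ sep ?map_f // eqxx mulr1.
rewrite big1_seq ?addr0 // => b /andP [bb0 bs].
rewrite scalarZ sep ?map_f //; case: eqP => [/idx_inj e|]; last by rewrite mulr0.
by rewrite e ?eqxx in bb0.
Qed.

End ClusterExpansions.

(** * Spanning *)

Section Spanning.
Variables (S : comNzRingType) (E : comAlgType S) (B : set E) (u : E).
Variable z : int -> E.
Hypotheses (zP : linear_rec 1 u z)
  (z01 : z 0 ^+ 2 + z 1 ^+ 2 + 1 = u * z 0 * z 1).
Local Notation W := (lincombs setT B).
Hypothesis span_form : forall i, normal_index i -> W (basis_form u z i).
Hypothesis span_ind : forall b, B b -> exists s i, b = s *: basis_form u z i.

Let WD x y : W x -> W y -> W (x + y).
Proof. by apply: lincombsD. Qed.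

Let WZ s x : W x -> W (s *: x).
Proof. by apply: lincombsZ. Qed.

Let WB x y : W x -> W y -> W (x - y).
Proof. by move=> Wx Wy; rewrite -scaleN1r; apply/WD/WZ. Qed.

Let W_monomial m a b : W (z m ^+ a * z (m + 1) ^+ b).
Proof.
have [m' [a' [b' [ni ->]]]] := normal_monomial z m a b.
exact: (span_form ni).
Qed.

Let W1 : W 1.
Proof. by have := W_monomial 0 0 0; rewrite !expr0 mulr1. Qed.

Let W_chebyshev n : W (chebyshev 1 u n).
Proof. by case: n => [|n]; [exact: W1 | exact: (@span_form (inr n))]. Qed.

Let W_ind (P : E -> Prop) : (forall x y, P x -> P y -> P (x + y)) ->
  (forall s x, P x -> P (s *: x)) ->
  (forall m a b, P (z m ^+ a * z (m + 1) ^+ b)) ->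
  (forall n, P (chebyshev 1 u n.+1)) -> forall x, W x -> P x.
Proof.
move=> PD PZ Pm Pc x [s [c [sB _ ->]]]; rewrite big_seq.
elim/big_ind: _ => // [|b /sB /span_ind [t [i ->]]].
  by rewrite -(scale0r (z 0 ^+ 0 * z (0 + 1) ^+ 0)); apply: PZ.
by apply/PZ/PZ; case: i => [[[m e] f]|n]; [exact: Pm | exact: Pc].
Qed.

(** Distribute u over the leftmost variable: z_m^(a+1) z_(m+1)^b times u contains
    z_(m-1), which is absorbed by z_(m+1) through the exchange relation. *)
Let W_u x : W x -> W (u * x).
Proof.
have Wpos m a b : W (u * (z m ^+ a.+1 * z (m + 1) ^+ b)).
  have -> : u * (z m ^+ a.+1 * z (m + 1) ^+ b) =
      z m ^+ a * z (m + 1) ^+ b.+1 + z (m - 1) * z m ^+ a * z (m + 1) ^+ b.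
    rewrite exprS !mulrA -zP mul1r exprS; ring.
  apply: WD => //; case: b => [|b].
    rewrite expr0 mulr1 -[z (m - 1)]expr1 -{2}[m](subrK 1); exact: W_monomial.
  have -> : z (m - 1) * z m ^+ a * z (m + 1) ^+ b.+1 =
      z m ^+ a.+2 * z (m + 1) ^+ b + z m ^+ a * z (m + 1) ^+ b.
    transitivity ((z (m - 1) * z (m + 1)) * (z m ^+ a * z (m + 1) ^+ b)).
      by rewrite exprS; ring.
    by rewrite (markov_exchange zP z01) !exprS; ring.
  exact: WD.
move: x; apply: W_ind => [x y|s x|m a b|n].
- by rewrite mulrDr; exact: WD.
- by rewrite -scalerAr; exact: WZ.
- case: a => [|a] //; case: b => [|b].
    by rewrite !expr0 !mulr1; exact: (W_chebyshev 1).
  by have := Wpos (m + 1) b 0; rewrite !expr0 mul1r mulr1.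
case: n => [|n].
  have -> : u * chebyshev 1 u 1 = chebyshev 1 u 2 + (1 + 1).
    by rewrite /=; ring.
  exact/WD/WD.
have -> : u * chebyshev 1 u n.+2 = chebyshev 1 u n.+3 + chebyshev 1 u n.+1.
  by rewrite chebyshevSS mul1r subrK.
exact: WD.
Qed.

(** Clear for the two variables z_m, z_(m+1) of a monomial; the recurrence and
    stability under u reach the other indices. *)
Let W_z k x : W x -> W (z k * x).
Proof.
move: x; apply: W_ind => [x y|s x|m a b|n].
- by rewrite mulrDr; exact: WD.
- by rewrite -scalerAr; exact: WZ.
- move: k; apply: (@int_ind2 _ m) => [||k h1 h0|k h1 h0].
  + by rewrite mulrA -exprS.
  + by rewrite mulrCA -exprS.
  + rewrite (linear_rec_next zP) mul1r mulrBl -mulrA; exact/WB/h1/W_u.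
  + have -> : z (k - 1) = u * z k - z (k + 1).
      by rewrite -zP mul1r [z (k + 1) + _]addrC addrK.
    rewrite mulrBl -mulrA; exact/WB/h1/W_u.
rewrite mulrC (chebyshev_shift zP) expr1n mul1r.
by apply: WD; [have := W_monomial (k + n.+1%:Z) 1 0 | have :=
  W_monomial (k - n.+1%:Z) 1 0];
  rewrite expr1 expr0 mulr1.
Qed.

(** Multiplication by basis elements reduces to multiplication by u and by the
    z_k. *)
Lemma span_mul x y : W x -> W y -> W (x * y).
Proof.
move=> Wx Wy; move: x Wx; apply: W_ind => [x1 x2|s x|m a b|n].
- by rewrite mulrDl; exact: WD.
- by rewrite -scalerAl; exact: WZ.
- have WXn k c x : W x -> W (z k ^+ c * x).
    by move=> Wx; elim: c => [|c IH]; rewrite ?expr0 ?mul1r // exprS -mulrA;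
      exact: W_z.
  by rewrite -mulrA; exact/WXn/WXn.
have Wc k : W (chebyshev 1 u k * y).
  elim/chebyshev_ind: k => [|||k IH1 IH2].
  - by rewrite mul1r.
  - exact: W_u.
  - have -> : chebyshev 1 u 2 * y = u * (u * y) - (y + y) by rewrite /=; ring.
    by apply: WB; [exact/W_u/W_u | exact: WD].
  - rewrite chebyshevSS mulrBl mul1r -mulrA.
    by apply: WB => //; exact: W_u.
exact: Wc.
Qed.

End Spanning.

(** * The canonically positive basis *)

Lemma ca_var_at_position w p l h : at_position p l h (seed_at kronecker w) ->
  ca_var kronecker w l = ca_line p /\ ca_var kronecker w h = ca_line (p + 1).
Proof.
by move=> wp; split; apply: ca_val_inj; rewrite /= /cluster_var ?(pos_varl wp)
  ?(pos_varh wp).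
Qed.

Section Monomials.
Variables (G : zmodType) (C : comAlgType (group_ring G)) (mon : int -> int -> C).
Variable slice : int -> int -> {scalar C}.
Hypotheses (mon0 : mon 0 0 = 1)
  (monD : forall i j k l, mon i j * mon k l = mon (i + k) (j + l))
  (slice_mon : forall i j k l, slice i j (mon k l) = ((k, l) == (i, j))%:R).

Definition is_term (x : C) := exists g i j, x = gr_exp g *: mon i j.

Lemma is_term1 : is_term 1.
Proof. by exists 0, 0, 0; rewrite mon0 gr_exp0 scale1r. Qed.

Lemma is_termM x y : is_term x -> is_term y -> is_term (x * y).
Proof.
move=> [g [i [j ->]]] [g' [i' [j' ->]]]; exists (g + g'), (i + i'), (j + j').
by rewrite -scalerAl -scalerAr scalerA monD gr_expD.
Qed.

Lemma is_termXn x n : is_term x -> is_term (x ^+ n).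
Proof.
move=> xt; elim: n => [|n IH]; first exact: is_term1.
by rewrite exprS; apply: is_termM.
Qed.

Lemma is_term_prod (T : Type) (r : seq T) (f : T -> C) :
  (forall i, is_term (f i)) -> is_term (\prod_(i <- r) f i).
Proof. by move=> ft; apply: big_ind => //; [exact: is_term1 | exact: is_termM].
  Qed.

Lemma is_termV x : is_term x -> exists2 y, is_term y & y * x = 1.
Proof.
move=> [g [i [j ->]]]; exists (gr_exp (- g) *: mon (- i) (- j));
  first by exists (- g), (- i), (- j).
by rewrite -scalerAl -scalerAr scalerA gr_expK scale1r monD !addNr mon0.
Qed.

Lemma slice_term_nonneg s x k l : gr_nonneg s -> is_term x ->
  gr_nonneg (slice k l (s *: x)).
Proof.
move=> s0 [g [i [j ->]]]; rewrite scalerA scalarZ slice_mon.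
apply: gr_nonnegM; first exact/gr_nonnegM/gr_nonneg_exp.
by case: eqP => _; [exact: gr_nonneg1 | exact: gr_nonneg0].
Qed.

End Monomials.

Section KroneckerBasis.
Variables (G : zmodType) (half : {additive 'rV[int]_2 -> G}).
Local Notation S := (group_ring G).
Local Notation yroot := (fun v => gr_exp (half v) : S).
Variables (E : comAlgType S) (j : {rmorphism A -> E}) (phi : ZP 2 -> S).
Hypothesis j_scale : forall (r : ZP 2) (a : A), j (r *: a) = phi r *: j a.
Hypothesis phi_exp : forall v, phi (gr_exp v) = yroot (v *+ 2).
Hypothesis generated_by_j : forall V : {pred E}, subalg_closed V ->
  (forall a, j a \in V) -> forall x, x \in V.
Variables (C : comAlgType S) (h : {lrmorphism E -> C}) (mon : int -> int -> C).
Variable slice : int -> int -> {scalar C}.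
Hypotheses (mon0 : mon 0 0 = 1)
  (monD : forall i j k l, mon i j * mon k l = mon (i + k) (j + l))
  (slice_mon : forall i j k l, slice i j (mon k l) = ((k, l) == (i, j))%:R).
Hypotheses (h0 : h (j (ca_line 0)) = mon 1 0) (h1 : h (j (ca_line 1)) = mon 0 1).

Let yrootD v w : yroot (v + w) = yroot v * yroot w.
Proof. by rewrite /= raddfD gr_expD. Qed.

Let yroot0 : yroot 0 = 1.
Proof. by rewrite /= raddf0 gr_exp0. Qed.

Let yNK v : yroot (- v) * yroot v = 1.
Proof. exact: (yrootNK yroot0 yrootD). Qed.

Let j_exp v (a : A) : j (gr_exp v *: a) = yroot (v *+ 2) *: j a.
Proof. by rewrite j_scale phi_exp. Qed.

Local Notation z := (rescaled_var j yroot).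
Local Notation u := (rescaled_u j yroot).

Let zP : linear_rec 1 u z := rescaled_var_rec yrootD j_exp.
Let z01 := rescaled_var_01 yroot0 yrootD j_exp.

Let form i : E := basis_form u z i.

Let j_basis i : j (basis_ca i) = yroot (basis_exponent i) *: form i.
Proof. exact: j_basis_ca yroot0 yrootD j_exp i. Qed.

Let form_j i : form i = yroot (- basis_exponent i) *: j (basis_ca i).
Proof. by rewrite j_basis scalerA yNK scale1r. Qed.

Let indep01 : alg_indep2 (z 0) (z 1).
Proof.
move=> P P0.
apply: (alg_indep2_mon mon0 monD slice_mon (yNK (g_exponent 0)) (yNK
  (g_exponent 1))).
have := congr1 h P0; rewrite eval2_lrmorph raddf0 => <-.
by rewrite /rescaled_var !linearZ /= h0 h1.
Qed.

Local Notation B := (j @` (@ca_val 2 2 kronecker @^-1` kronecker_basis)).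

Let BP b : B b <-> exists2 i, normal_index i & b = j (basis_ca i).
Proof.
split=> [[a /kronecker_basisP [i ni ->] <-]|[i ni ->]]; first by exists i.
by exists (basis_ca i) => //; apply/kronecker_basisP; exists i.
Qed.

(** Every coefficient of a combination of basis elements is visible, up to an
    invertible monomial, in the Laurent expansion in a suitable cluster. *)
Lemma kronecker_coefficient (s : seq E) (c : E -> S) b0 :
    uniq s -> (forall b, b \in s -> B b) -> b0 \in s ->
  exists p k l g x, expands_at mon z p (\sum_(b <- s) c b *: b) x /\
    slice k l x = c b0 * gr_exp g.
Proof.
move=> us sB b0s.
have /choice [idx idxP] : forall b, exists i, B b ->
  normal_index i /\ b = j (basis_ca i).
  move=> b; have [/BP [i ni bi]|nB] := EM (B b); first by exists i.
  by exists (inr 0%N).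
have idx_inj : {in s &, injective idx}.
  move=> b b' /sB /idxP [_ bE] /sB /idxP [_ b'E] e.
  by rewrite bE b'E e.
have ns b : b \in s -> normal_index (idx b) by move=> /sB /idxP [].
have [p [k [l [x [ex slx]]]]] := coefficient_slice mon0 monD slice_mon zP z01
  (fun b => c b * yroot (basis_exponent (idx b))) us idx_inj ns b0s.
exists p, k, l, (half (basis_exponent (idx b0))), x; split=> //.
move: ex; rewrite (eq_big_seq (fun b => c b *: b)) // => b /sB /idxP [_ bE].
by rewrite -scalerA -[_ *: basis_form _ _ _]j_basis -bE.
Qed.

Lemma kronecker_lin_independent : lin_independent B.
Proof.
move=> s c us sB s0 b bs.
have [p [k [l [g [x [ex slx]]]]]] := kronecker_coefficient c us sB bs.
have x0 : x = 0.
  rewrite s0 in ex.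
  exact: (expands_at_unique mon0 monD zP z01 indep01 ex (expands_at0 mon z p)).
move: slx; rewrite x0 raddf0; move/(congr1 ( *%R^~ (gr_exp (- g)))).
by rewrite mul0r -mulrA [gr_exp g * _]mulrC gr_expK mulr1 => <-.
Qed.

Local Notation W := (lincombs setT B).

Let span_form i : normal_index i -> W (form i).
Proof.
move=> ni; rewrite form_j; apply: lincombsZ => //.
by apply: lincombs_gen => //; apply/BP; exists i.
Qed.

Let span_ind b : B b -> exists s i, b = s *: form i.
Proof. by move=> /BP [i _ ->]; rewrite j_basis; eexists; eexists. Qed.

Let span_line k : W (j (ca_line k)).
Proof.
have -> : j (ca_line k) = j (basis_ca (inl (k, 1%N, 0%N))).
  by congr (j _); rewrite /basis_ca expr1 expr0 mulr1.
by apply: lincombs_gen => //; apply/BP; exists (inl (k, 1%N, 0%N)).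
Qed.

Let span1 : W 1.
Proof. by have := span_form (i := inl (0, 0%N, 0%N)) isT;
  rewrite /form /= !expr0 mulr1. Qed.

Let span_algebra (a : A) : W (j a).
Proof.
suff gen x : in_cluster_algebra kronecker x ->
    forall xA : x \in cluster_pred kronecker, W (j (ClusterAlgebra xA)).
  by case: a => x xA; apply: gen; apply/asboolP; exact: xA.
elim=> {x}.
- move=> r rA; have -> : ClusterAlgebra rA = r *: (1 : A).
    by apply: ca_val_inj; rewrite /= mulr1.
  by rewrite j_scale rmorph1; apply: lincombsZ.
- move=> w i xA; have [k wk] := cluster_var_line w i.
  have -> : ClusterAlgebra xA = ca_line k by apply: ca_val_inj.
  exact: span_line.
- move=> x y Ax IHx Ay IHy xyA.
  have -> : ClusterAlgebra xyA =
      ClusterAlgebra (introT (asboolP _) Ax : x \in cluster_pred kronecker)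
      + ClusterAlgebra (introT (asboolP _) Ay : y \in cluster_pred kronecker).
    exact: ca_val_inj.
  by rewrite rmorphD; apply: lincombsD.
- move=> x y Ax IHx Ay IHy xyA.
  have -> : ClusterAlgebra xyA =
      ClusterAlgebra (introT (asboolP _) Ax : x \in cluster_pred kronecker)
      * ClusterAlgebra (introT (asboolP _) Ay : y \in cluster_pred kronecker).
    exact: ca_val_inj.
  by rewrite rmorphM; apply: (span_mul zP z01 span_form span_ind).
Qed.

Lemma kronecker_spanning x : W x.
Proof.
pose V : {pred E} := fun x => `[< W x >].
have inV y : (y \in V) = `[< W y >] by [].
suff : x \in V by rewrite inV => /asboolP.
apply: generated_by_j => [|a]; last by rewrite inV; apply/asboolP/span_algebra.
split=> [|s y w|y w]; rewrite !inV.
- exact/asboolP/span1.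
- move=> /asboolP Wy /asboolP Ww; apply/asboolP.
  by apply: lincombsD => //; apply: lincombsZ.
- move=> /asboolP Wy /asboolP Ww; apply/asboolP.
  exact: (span_mul zP z01 span_form span_ind).
Qed.

Local Notation cluster w := (fun i => j (ca_var kronecker w i)).

Let cluster_low w p l h' : at_position p l h' (seed_at kronecker w) ->
  cluster w l = yroot (- g_exponent p) *: z p.
Proof.
by move=> /ca_var_at_position [-> _]; rewrite scalerA yNK scale1r.
Qed.

Let cluster_high w p l h' : at_position p l h' (seed_at kronecker w) ->
  cluster w h' = yroot (- g_exponent (p + 1)) *: z (p + 1).
Proof.
by move=> /ca_var_at_position [_ ->]; rewrite scalerA yNK scale1r.
Qed.

(** Coefficients of an expansion that comes from a nonnegative polynomial are
    nonnegative, as the variables of the seed are those of the expansion up to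
    invertible monomials. *)
Lemma positive_slices w p l h' e x k m : at_position p l h' (seed_at kronecker
  w) ->
  positive_in (cluster w) e -> expands_at mon z p e x -> gr_nonneg (slice k m x).
Proof.
move=> wp [a [P [P0 Pe]]] ex.
pose y i : C := if i == l then yroot (- g_exponent p) *: mon 1 0
  else yroot (- g_exponent (p + 1)) *: mon 0 1.
have yt i : is_term mon (y i) by rewrite /y; case: ifP => _; do 3!eexists.
have ey i : expands_at mon z p (cluster w i) (y i).
  case: (ord2_pairP i (pos_neq wp)) => ->; rewrite /y.
    by rewrite eqxx (cluster_low wp); apply: expands_atZ; exact: expands_at_low.
  rewrite eq_sym (negbTE (pos_neq wp)) (cluster_high wp); apply: expands_atZ.
  exact: expands_at_high.
have yE : (\prod_(i < 2) y i ^+ a i) * x = mmap (in_alg C) y P.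
  apply: (expands_at_unique mon0 monD zP z01 indep01 (p := p) (e :=
    mmap (in_alg E) (cluster w) P)).
    rewrite -Pe; apply: expands_atM ex.
    by apply: expands_at_prod => i; apply: expands_atXn.
  apply: expands_at_sum => u'; apply: expands_atM; first exact: expands_at_scalar.
  by apply: expands_at_prod => i; apply: expands_atXn.
have [t tt tV] : exists2 t, is_term mon t & t * (\prod_(i < 2) y i ^+ a i) = 1.
  by apply: is_termV => //; apply: is_term_prod => // i; apply: is_termXn.
have -> : x = t * mmap (in_alg C) y P by rewrite -yE mulrA tV mul1r.
rewrite /mmap mulr_sumr raddf_sum; apply: gr_nonneg_sum => v _ /=.
rewrite mulr_algl -scalerAr; apply: slice_term_nonneg => //.
by apply: is_termM => //; apply: is_term_prod => // i; apply: is_termXn.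
Qed.

(** Seen from the cluster p, the variables to its right are reached by the
    subtraction-free recurrence, those to its left after a reflection, and F_n is
    the quotient of z_(p+n) + z_(p-n) by z_p. *)
Lemma kronecker_basis_positive w b : B b -> positive_in (cluster w) b.
Proof.
move=> /BP [i _ ->]; have [p [l [h' wp]]] := position_of_word w.
have zl : z p = yroot (g_exponent p) *: cluster w l.
  by rewrite (cluster_low wp) scalerA [_ * _]mulrC yNK scale1r.
have zh : z (p + 1) = yroot (g_exponent (p + 1)) *: cluster w h'.
  by rewrite (cluster_high wp) scalerA [_ * _]mulrC yNK scale1r.
have Pl : positive_in (cluster w) (z p).
  by rewrite zl; apply/positive_inZ/positive_in_var/gr_nonneg_exp.
have Ph : positive_in (cluster w) (z (p + 1)).
  by rewrite zh; apply/positive_inZ/positive_in_var/gr_nonneg_exp.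
have dl e : positive_in (cluster w) (z p * e) -> positive_in (cluster w) e.
  move=> pe; apply: (@positive_in_div _ _ _ _ l).
  by rewrite (cluster_low wp) -scalerAl; apply/positive_inZ/pe/gr_nonneg_exp.
have dh e : positive_in (cluster w) (z (p + 1) * e) -> positive_in (cluster w) e.
  move=> pe; apply: (@positive_in_div _ _ _ _ h').
  by rewrite (cluster_high wp) -scalerAl; apply/positive_inZ/pe/gr_nonneg_exp.
have zpos k : positive_in (cluster w) (z k).
  case: (leP p k) => [lek|/ltW lek].
    have -> : k = p + (absz (k - p)%R)%:Z by lia.
    apply: (positive_forward (Pos := positive_in (cluster w)) (markov_shift zP
      p));
      rewrite ?addr0 //; [by rewrite (markov_triple zP z01) | exact: positive_in0
      |exact: positive_in1| exact: positive_inD | exact: positive_inM].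
  have -> : k = p + 1 - (absz (p + 1 - k)%R)%:Z by lia.
  apply: (positive_forward (Pos := positive_in (cluster w)) (markov_reflect zP
    (p + 1)));
    rewrite ?subr0 ?addrK //; [ | exact: positive_in0
      |exact: positive_in1| exact: positive_inD | exact: positive_inM].
  by rewrite [X in X + 1]addrC (markov_triple zP z01); ring.
rewrite j_basis; apply/positive_inZ; first exact: gr_nonneg_exp.
case: i => [[[m a] b']|n]; rewrite /form /basis_form.
  by apply: positive_inM; apply: positive_inXn.
apply: dl; rewrite mulrC (chebyshev_shift zP) expr1n mul1r.
exact: positive_inD.
Qed.

(** An element that is positive in all clusters has nonnegative coefficients in the
    basis, because each of them is a coefficient of one of its expansions. *)
Lemma kronecker_canonically_positive :
  [set e | forall w, positive_in (cluster w) e] = lincombs (gr_nonneg (G := G)) B.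
Proof.
apply/seteqP; split=> e /=.
  move=> ePos; have [] := lincombs_uniq _ _ (kronecker_spanning e) => //.
  move=> s [c [us sB _ eE]]; exists s, c; split=> // b bs.
  have [p [k [l [g [x [ex slx]]]]]] := kronecker_coefficient c us sB bs.
  have [w [l' [h' wp]]] := word_of_position p.
  apply: (@gr_nonneg_mul_exp _ _ g); rewrite -slx.
  by apply: (positive_slices k l wp (ePos w)); rewrite eE.
move=> [s [c [sB c0 ->]]] w; apply: positive_in_sum => b bs.
by apply: positive_inZ; [exact: c0 | exact/kronecker_basis_positive/sB].
Qed.

Lemma basis_ca_inj i i' : normal_index i -> normal_index i' ->
  basis_ca i = basis_ca i' -> i = i'.
Proof.
move=> ni ni' e; apply/eqP; apply: contraT => ii'.
have nI : all normal_index [:: i; i'] by rewrite /= ni ni'.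
have [p [k [l sep]]] := separating_slice mon0 monD slice_mon nI ni.
have := congr1 j e; rewrite !j_basis => e'.
have ex i0 : expands_at mon z p (yroot (basis_exponent i0) *: form i0)
    (yroot (basis_exponent i0) *: laurent_form mon p i0).
  exact/expands_atZ/(expands_at_form mon0 monD zP z01).
have exi := ex i; rewrite e' in exi.
have := expands_at_unique mon0 monD zP z01 indep01 exi (ex i').
move/(congr1 (slice k l)); rewrite !scalarZ !sep ?inE ?eqxx ?orbT //.
rewrite eq_sym (negbTE ii') mulr0 mulr1.
move/(congr1 ( *%R (yroot (- basis_exponent i)))); rewrite yNK mulr0 => /eqP.
by rewrite oner_eq0.
Qed.

Lemma kronecker_disjoint : cluster_monomials kronecker `&` kronecker_F = set0.
Proof.
apply/seteqP; split=> // x [/cluster_monomialP [m [a [b xE]]] [n /= n0 xF]].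
have [m' [a' [b' [ni eq']]]] := normal_monomial line_var m a b.
case: n n0 xF => // n _ xF.
suff : inl (m', a', b') = inr n :> basis_index by [].
apply: basis_ca_inj => //; apply: ca_val_inj.
by rewrite ca_val_line ca_val_chebyshev -eq' -xE.
Qed.

End KroneckerBasis.

Lemma kronecker_basis_in : kronecker_basis `<=` in_cluster_algebra kronecker.
Proof.
move=> x [/cluster_monomialP [m [a [b ->]]]|[n _ <-]].
  by rewrite -ca_val_line; apply/asboolP; exact: ca_valP.
by rewrite -ca_val_chebyshev; apply/asboolP; exact: ca_valP.
Qed.

Theorem theorem7p3 (Ahat : comAlgType (ZPhat 2))
    (j : {lrmorphism cluster_algebra kronecker -> Ahat | @completion 2 \; *:%R})
    (Ahat_ext : is_scalar_extension j) :
  [/\ cluster_monomials kronecker `&` kronecker_F = set0,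
      kronecker_basis `<=` in_cluster_algebra kronecker
    & canonically_positive_basis j
        (j @` (@ca_val 2 2 kronecker @^-1` kronecker_basis))].
Proof.
have [C [f [mon [slice [mon0 monD slice_mon fx1 fx2]]]]] :=
  kronecker_laurent_model.
have [h hj _] := Ahat_ext C f.
have j_scale (r : ZP 2) (a : cluster_algebra kronecker) :
  j (r *: a) = completion r *: j a by exact: linearZ.
have phi_exp v : completion (gr_exp v) = gr_exp (half_vec (v *+ 2)).
  by rewrite completion_exp half_vecMn2.
have gen (V : {pred Ahat}) : subalg_closed V -> (forall a, j a \in V) ->
    forall x, x \in V.
  by move=> Vc jV; exact: scalar_extension_generated Vc jV Ahat_ext.
have h0 : h (j (ca_line 0)) = mon 1 0.
  exact: etrans (hj (ca_line 0)) (fx1 (ca_line 0) line_var0).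
have h1 : h (j (ca_line 1)) = mon 0 1.
  exact: etrans (hj (ca_line 1)) (fx2 (ca_line 1) line_var1).
split.
- exact: (kronecker_disjoint j_scale phi_exp mon0 monD slice_mon h0 h1).
- exact: kronecker_basis_in.
split; last first.
  exact: (kronecker_canonically_positive j_scale phi_exp gen mon0 monD
    slice_mon h0 h1).
split.
  exact: (kronecker_lin_independent j_scale phi_exp mon0 monD slice_mon h0 h1).
apply/seteqP; split=> // x _.
exact: (kronecker_spanning j_scale phi_exp gen).
Qed.
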